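(* Let $\epsilon_n\ge0$, $\epsilon_n\to0$, and let $\{W_i\}$ be i.i.d. with law $\lambda_0\in\mathcal{P}(\mathcal{W})$. For each $n$ and $\vec w\in\mathcal{W}^n$ let $(\hat x^n_1(\vec w),\dots,\hat x^n_n(\vec w))$ be an $\epsilon_n$-Nash equilibrium with type vector $\vec w$, each $\hat x^n_i$ universally measurable, and let $\mu_n=\frac1n\sum_{i=1}^n\delta_{(W_i,\hat x^n_i(W_1,\dots,W_n))}$. Then for every measurable $A\subset\mathcal{P}(\mathcal{W}\times\mathcal{X})$: $$\limsup_{n\to\infty}\frac1n\log\mathbb{P}(\mu_n\in A)\le-\inf\{H(m^w|\lambda_0):m\in\overline{A}\cap\mathcal{M}\},$$ $$\liminf_{n\to\infty}\frac1n\log\mathbb{P}(\mu_n\in A)\ge-\inf\{H(\lambda|\lambda_0):\lambda\in\mathcal{P}(\mathcal{W}),\ \mathcal{M}(\lambda)\subset A^\circ\}.$$ Moreover, if $\mathcal{M}(\lambda)$ is a singleton for every $\lambda\ll\lambda_0$, then $$\liminf_{n\to\infty}\frac1n\log\mathbb{P}(\mu_n\in A)\ge-\inf\{H(m^w|\lambda_0):m\in A^\circ\cap\mathcal{M}\}.$$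
   Context: Standing assumptions: $\mathcal{X}$ compact metric space, $\mathcal{W}$ complete separable metric space; $\mathcal{P}(S)$ = Borel probability measures on $S$ with the weak topology. $\mathcal{C}$ maps $w$ to a nonempty closed $\mathcal{C}(w)\subset\mathcal{X}$, continuous in the sense that $\mathrm{Gr}(\mathcal{C})=\{(w,x):x\in\mathcal{C}(w)\}$ is closed and whenever $w_n\to w$, $x\in\mathcal{C}(w)$ there exist $n_k$, $x_{n_k}\in\mathcal{C}(w_{n_k})$ with $x_{n_k}\to x$. $F:\mathcal{P}(\mathcal{W}\times\mathcal{X})\times\mathcal{W}\times\mathcal{X}\to\mathbb{R}$ bounded continuous. For $\epsilon\ge0$, an $\epsilon$-Nash equilibrium with type vector $(w_1,\dots,w_n)$ is $(x_1,\dots,x_n)$ with $x_i\in\mathcal{C}(w_i)$ and, with $m=\frac1n\sum_k\delta_{(w_k,x_k)}$, $F(m,w_i,x_i)-\inf_{y\in\mathcal{C}(w_i)}F(m+\frac1n(\delta_{(w_i,y)}-\delta_{(w_i,x_i)}),w_i,y)\le\epsilon$ for all $i$. $m^w$ = first marginal. $\mathcal{M}(\lambda)$ = set of $m$ with $m^w=\lambda$ such that for $m$-a.e. $(w,x)$, $x\in\mathcal{C}(w)$ and $F(m,w,x)=\inf_{y\in\mathcal{C}(w)}F(m,w,y)$; $\mathcal{M}=\bigcup_\lambda\mathcal{M}(\lambda)$. $H$ = relative entropy ($+\infty$ unless absolutely continuous); $\inf\emptyset=\infty$. *)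

(* Defs.v *)
From HB Require Import structures.
From mathcomp Require Import all_boot all_order all_algebra.
From mathcomp Require Import all_classical all_reals all_analysis.

Set Implicit Arguments.
Unset Strict Implicit.
Unset Printing Implicit Defensive.

Import Order.TTheory GRing.Theory Num.Theory.
Import numFieldNormedType.Exports.

Local Open Scope classical_set_scope.
Local Open Scope ring_scope.

Definition borel (T : ptopologicalType) := g_sigma_algebraType (@open T).

Section Defs.
Context {R : realType}.

(** sequence extension of a finite profile (only indices < n are used) *)
Definition pnat {T : pointedType} n (p : 'I_n -> T) (k : nat) : T :=
  if insub k is Some i then p i else point.

(** empirical measure (1/n) \sum_{i<n} \delta_{p i}  (for n >= 1) *)
Definition empirical d (T : measurableType d) n (p : 'I_n -> T)
  : probability T R :=
  mnormalize (msum (fun k => \d_(pnat p k)) n) \d_point.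

(** outer probability, i.e. the value of the completed measure *)
Definition pout d (T : measurableType d) (P : probability T R) (S : set T)
  : \bar R := ereal_inf [set P F | F in [set F | measurable F /\ S `<=` F]].

Definition univ_meas d (T : measurableType d) d' (U : measurableType d')
  (f : T -> U) :=
  forall Q : probability T R, forall B : set U, measurable B ->
    exists E F : set T, [/\ measurable E, measurable F,
      E `<=` f @^-1` B, f @^-1` B `<=` F & Q (F `\` E) = 0%E].

Definition density d (T : measurableType d) (lam lam0 : probability T R)
  (f : T -> R) :=
  [/\ measurable_fun setT f, (forall t, 0 <= f t) &
      forall E, measurable E -> lam E = (\int[lam0]_(t in E) (f t)%:E)%E].

Definition relent d (T : measurableType d) (lam lam0 : probability T R)
  : \bar R :=
  ereal_inf [set (\int[lam0]_t (f t * ln (f t))%:E)%E | f in density lam lam0].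

Definition abs_cont d (T : measurableType d) (lam lam0 : probability T R) :=
  forall E, measurable E -> lam0 E = 0%E -> lam E = 0%E.

Definition meq d (T : measurableType d) (m m' : probability T R) :=
  forall E, measurable E -> m E = m' E.

Section WX.
Context (W X : ptopologicalType).

Local Notation PS := (probability (borel W * borel X)%type R).

Definition bdd_cont (f : W * X -> R) :=
  continuous f /\ exists M : R, forall z, `|f z| <= M.

Definition integ (m : PS) (f : W * X -> R) : \bar R :=
  (\int[m]_z (f z)%:E)%E.

Definition weak_open (U : set PS) :=
  forall m, U m -> exists k (fs : 'I_k -> W * X -> R) (e : R),
    [/\ 0 < e, forall i, bdd_cont (fs i) &
       [set m' | forall i, (`| integ m' (fs i) - integ m (fs i) | < e%:E)%E]
         `<=` U].

Definition weak_closure (A : set PS) :=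
  [set m | forall U, weak_open U -> U m -> U `&` A !=set0].

Definition weak_interior (A : set PS) :=
  [set m | exists U, [/\ weak_open U, U m & U `<=` A]].

Definition weak_measurable (A : set PS) := <<s weak_open >> A.

Definition bdd_cont_F (F : PS -> W -> X -> R) :=
  (exists M : R, forall m w x, `|F m w x| <= M) /\
  forall m w x e, 0 < e -> exists U (V : set W) (V' : set X),
    [/\ weak_open U, U m, nbhs w V, nbhs x V' &
        forall m' w' x', U m' -> V w' -> V' x' -> `|F m' w' x' - F m w x| < e].

Definition constraint_ok (C : W -> set X) :=
  [/\ forall w, C w !=set0,
      forall w, closed (C w),
      closed [set p : W * X | C p.1 p.2] &
      forall (ws : nat -> W) w x, ws @ \oo --> w -> C w x ->
        exists (phi : nat -> nat) (xs : nat -> X),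
          [/\ {homo phi : a b / (a < b)%N},
              forall k, C (ws (phi k)) (xs k) & xs @ \oo --> x]].

Definition eps_nash (C : W -> set X) (F : PS -> W -> X -> R) (eps : R) n
  (w : 'I_n -> W) (x : 'I_n -> X) :=
  forall i : 'I_n, C (w i) (x i) /\
    F (empirical (fun k => (w k, x k) : borel W * borel X)) (w i) (x i)
    - inf [set F (empirical (fun k => (w k, if k == i then y else x k)
                                      : borel W * borel X)) (w i) y
          | y in C (w i)] <= eps.

Definition marg_w (m : PS) (lam : probability (borel W) R) :=
  forall E : set (borel W), measurable E -> m (E `*` setT) = lam E.

Definition Mset (C : W -> set X) (F : PS -> W -> X -> R)
  (lam : probability (borel W) R) : set PS :=
  [set m | marg_w m lam /\
     {ae m, forall z : borel W * borel X,
        C z.1 z.2 /\ F m z.1 z.2 = inf [set F m z.1 y | y in C z.1]}].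

Definition Mall C F : set PS := [set m | exists lam, Mset C F lam m].

Definition relent_w (lam0 : probability (borel W) R) (m : PS) : \bar R :=
  ereal_inf [set relent lam lam0 | lam in marg_w m].

End WX.

Definition iid_law d (Om : measurableType d) (P : probability Om R)
  (T : ptopologicalType) (Ws : nat -> Om -> borel T)
  (lam0 : probability (borel T) R) :=
  (forall i, measurable_fun setT (Ws i)) /\
  forall n (E : 'I_n -> set (borel T)), (forall i, measurable (E i)) ->
    P (\bigcap_(i in [set: 'I_n]) (Ws i @^-1` E i)) =
    (\prod_(i < n) lam0 (E i))%E.

Definition cyl (T : ptopologicalType) n : set (set ('I_n -> borel T)) :=
  [set (fun v => v i) @^-1` E | i in [set: 'I_n] & E in measurable].

Definition prodn (T : ptopologicalType) n := g_sigma_algebraType (@cyl T n).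

End Defs.

(* Main.v *)
Require Import Defs.
From HB Require Import structures.
From mathcomp Require Import all_boot all_order all_algebra.
From mathcomp Require Import all_classical all_reals all_analysis.
From mathcomp Require Import measurable_realfun ring lra.
Import Order.TTheory GRing.Theory Num.Theory.
Import numFieldNormedType.Exports.
Local Open Scope classical_set_scope.
Local Open Scope ring_scope.

(** Ultrafilter limits replace compactness of spaces of measures. Along an ultrafilter of type
    vectors of growing size whose empirical measures converge setwise to [lam], the averages [f
    |-> 1/n \sum_i f (w_i, x_i)] converge to a positive functional on bounded continuous
    functions. Since [X] is compact and the types converge setwise, this functional is Daniell
    continuous, so it is integration against a probability [m] with first marginal [lam]. A
    point at which [m] violates feasibility or optimality has, by continuity of [F] and lower
    hemicontinuity of [C], a neighbourhood that contains no [(w_i, x_i)] for large samples; it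
    is [m]-null, and by the Lindelof property [m] belongs to [Mset C F lam].

    Consequently, if [Mset C F lam] lies in the interior of [A], setwise closeness of the
    empirical type distribution to [lam] on finitely many sets forces [mu_n] into [A], and the
    lower bound is the change of measure of Sanov's theorem with a density bounded away from
    [0] and infinity. For the upper bound, let [r] be below the rate. If, for all finite
    families of bounded measurable [g], arbitrarily large samples had [mu_n] in [A] and [1/n
    \sum_i g w_i < r + ln (\int expR g dlam0)] for each [g], an ultrafilter limit would be a
    finitely additive probability satisfying this variational inequality; the inequality makes
    it countably additive with relative entropy at most [r], and the limit point [m] above
    contradicts the choice of [r]. Hence finitely many exponential Chebyshev bounds cover
    [mu_n] in [A]. *)

Set Implicit Arguments.
Unset Strict Implicit.
Unset Printing Implicit Defensive.

(** * Bounded measurable functions *)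

Definition bmeas {R : realType} d {T : measurableType d} (f : T -> R) :=
  measurable_fun setT f /\ exists M : R, forall x, `|f x| <= M.

Section bmeas.
Context {R : realType} d {T : measurableType d}.
Implicit Types f g : T -> R.

Lemma bmeas_cst (c : R) : bmeas (fun _ : T => c).
Proof. by split; [exact: measurable_cst | exists `|c|]. Qed.

Lemma bmeas_indic (A : set T) : measurable A -> bmeas (\1_A : T -> R).
Proof.
move=> mA; split; first exact: measurable_indic.
by exists 1 => x; rewrite ger0_norm// indicE; case: (x \in A); rewrite ?ler01.
Qed.

Lemma bmeasD f g : bmeas f -> bmeas g -> bmeas (fun x => f x + g x).
Proof.
move=> [mf [M fM]] [mg [N gN]]; split; first exact: measurable_funD.
by exists (M + N) => z; rewrite (le_trans (ler_normD _ _))// lerD.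
Qed.

Lemma bmeasM f g : bmeas f -> bmeas g -> bmeas (fun x => f x * g x).
Proof.
move=> [mf [M fM]] [mg [N gN]]; split; first exact: measurable_funM.
by exists (M * N) => z; rewrite normrM ler_pM.
Qed.

Lemma bmeasZ c f : bmeas f -> bmeas (fun x => c * f x).
Proof. exact/bmeasM/bmeas_cst. Qed.

Lemma bmeasN f : bmeas f -> bmeas (fun x => - f x).
Proof. by move=> /(bmeasZ (-1)); under eq_fun do rewrite mulN1r. Qed.

Lemma bmeasB f g : bmeas f -> bmeas g -> bmeas (fun x => f x - g x).
Proof. by move=> bf bg; apply: bmeasD => //; exact: bmeasN. Qed.

Lemma bmeas_sum (I : Type) (r : seq I) (f : I -> T -> R) :
  (forall i, bmeas (f i)) -> bmeas (fun x => \sum_(i <- r) f i x).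
Proof.
move=> bf; elim: r => [|i r IH].
  by under eq_fun do rewrite big_nil; exact: bmeas_cst.
by under eq_fun do rewrite big_cons; exact: bmeasD.
Qed.

Lemma bmeas_prod (I : Type) (r : seq I) (f : I -> T -> R) :
  (forall i, bmeas (f i)) -> bmeas (fun x => \prod_(i <- r) f i x).
Proof.
move=> bf; elim: r => [|i r IH].
  by under eq_fun do rewrite big_nil; exact: bmeas_cst.
by under eq_fun do rewrite big_cons; exact: bmeasM.
Qed.

Lemma bmeas_expR f : bmeas f -> bmeas (fun x => expR (f x)).
Proof.
move=> [mf [M fM]]; split; first exact: measurableT_comp.
exists (expR M) => x; rewrite ger0_norm ?expR_ge0// ler_expR.
by rewrite (le_trans (ler_norm _)).
Qed.

Lemma bmeas_comp d' (U : measurableType d') (h : U -> T) f :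
  measurable_fun setT h -> bmeas f -> bmeas (fun x => f (h x)).
Proof.
move=> mh [mf [M fM]]; split; first exact: measurableT_comp.
by exists M => x.
Qed.

Variable m : probability T R.

Lemma bmeas_integrable f : bmeas f -> m.-integrable setT (EFin \o f).
Proof.
move=> [mf [M fM]]; apply: measurable_bounded_integrable => //.
  by rewrite -[X in (X < _)%E]/(m setT) probability_setT ltry.
by exists M; split; [rewrite num_real | move=> N MN x _ /=; rewrite (le_trans (fM x))// ltW].
Qed.

Lemma EFin_Rint f : bmeas f -> (\int[m]_x f x)%:E = (\int[m]_x (f x)%:E)%E.
Proof.
by move=> bf; rewrite fineK//; apply: integrable_fin_num => //; exact: bmeas_integrable.
Qed.

Lemma RintD f g : bmeas f -> bmeas g ->
  \int[m]_x (f x + g x) = \int[m]_x f x + \int[m]_x g x.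
Proof. by move=> bf bg; apply: RintegralD => //; exact: bmeas_integrable. Qed.

Lemma RintB f g : bmeas f -> bmeas g ->
  \int[m]_x (f x - g x) = \int[m]_x f x - \int[m]_x g x.
Proof. by move=> bf bg; apply: RintegralB => //; exact: bmeas_integrable. Qed.

Lemma RintZ c f : bmeas f -> \int[m]_x (c * f x) = c * \int[m]_x f x.
Proof. by move=> bf; apply: RintegralZl => //; exact: bmeas_integrable. Qed.

Lemma Rint_cst c : \int[m]_(x in setT) c = c :> R.
Proof.
by rewrite Rintegral_cst// -[X in fine X]/(m setT) probability_setT mulr1.
Qed.

Lemma le_Rint f g : bmeas f -> bmeas g -> (forall x, f x <= g x) ->
  \int[m]_x f x <= \int[m]_x g x.
Proof.
by move=> bf bg fg; apply: le_Rintegral => //; exact: bmeas_integrable.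
Qed.

Lemma Rint_ge0 f : (forall x, 0 <= f x) -> 0 <= \int[m]_x f x.
Proof. by move=> f0; apply: Rintegral_ge0 => x _. Qed.

Lemma Rint_indic (A : set T) : measurable A -> \int[m]_x \1_A x = fine (m A) :> R.
Proof. by move=> mA; rewrite /Rintegral integral_indic// setIT. Qed.

Lemma Rint_sum (I : Type) (r : seq I) (f : I -> T -> R) : (forall i, bmeas (f i)) ->
  \int[m]_x (\sum_(i <- r) f i x) = \sum_(i <- r) \int[m]_x f i x.
Proof.
move=> bf; elim: r => [|i r IH].
  by rewrite big_nil; under eq_Rintegral do rewrite big_nil; rewrite Rint_cst.
rewrite big_cons; under eq_Rintegral do rewrite big_cons.
by rewrite RintD ?IH//; exact: bmeas_sum.
Qed.

End bmeas.

(** * Layer-cake decomposition of a nonnegative real number *)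

Section layers.
Context {R : realType}.

(** The part of [y] between heights [j] and [j + 1]. It is continuous in [y], so a bounded
    continuous function is cut into bounded continuous slices. *)
Definition layer (j : nat) (y : R) := Num.min (Num.max (y - j%:R) 0) 1.

Lemma layer_ge0 j y : 0 <= layer j y.
Proof. by rewrite le_min ler01 andbT le_max lexx orbT. Qed.

Lemma layer_le1 j y : layer j y <= 1.
Proof. by rewrite ge_min lexx orbT. Qed.

Lemma layer0 j y : y <= j%:R -> layer j y = 0.
Proof.
by move=> yj; rewrite /layer (max_idPr _) ?subr_le0//; apply/min_idPl.
Qed.

Lemma layer1 j y : j.+1%:R <= y -> layer j y = 1.
Proof.
by move=> yj; apply/min_idPr; rewrite le_max lerBrDr addrC natr1 yj.
Qed.

Lemma sum_layer (N : nat) y : 0 <= y -> y <= N%:R -> \sum_(0 <= j < N) layer j y = y.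
Proof.
move=> y0; elim: N => [|N IH] yN.
  by rewrite big_nil; apply/eqP; rewrite eq_le y0 yN.
rewrite big_nat_recr//=; have [yN'|Ny] := leP y N%:R.
  by rewrite IH// layer0// addr0.
rewrite (@eq_big_nat _ _ _ _ _ _ (fun=> 1)); last first.
  move=> i /andP[_ iN]; rewrite layer1// (le_trans _ (ltW Ny))// ler_nat//.
rewrite sumr_const_nat subn0 /layer (max_idPl _) ?subr_ge0 ?ltW//.
rewrite (min_idPl _); first by rewrite addrC subrK.
by rewrite lerBlDr addrC natr1.
Qed.

(** Each slice [layer j y] rounded up to an indicator. Only the topmost slice can be fractional, so
    the total error is at most 1, and it becomes small after rescaling by [N]. *)
Definition layers (N : nat) (y : R) := \sum_(0 <= j < N) (j%:R < y)%R%:R : R.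

Lemma layers_ge N y : 0 <= y -> y <= N%:R -> y <= layers N y.
Proof.
move=> y0 yN; rewrite -[leLHS](sum_layer y0 yN); apply: ler_sum => j _.
by have [jy|jy] := ltP; [exact: layer_le1|rewrite layer0].
Qed.

Lemma layers_le N y : 0 <= y -> y <= N%:R -> layers N y <= y + 1.
Proof.
move=> y0; case: N => [|N] yN; first by rewrite /layers big_nil addr_ge0.
rewrite /layers big_nat_recl//= addrC lerD//; last by case: (_ < _).
rewrite -[leRHS](sum_layer y0 yN) big_nat_recr//= -[leLHS]addr0 lerD ?layer_ge0//.
apply: ler_sum => j _; have [jy|jy] := ltP; last exact: layer_ge0.
by rewrite layer1// ltW.
Qed.

End layers.

(** * Bounded continuous functions *)

Section dist_to_set.
Context {R : realType} {T : pseudoMetricType R}.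
Implicit Types (A O : set T) (z : T).

(** Truncation at 1 keeps the value real even for empty [A], where the extended distance is
    infinite. *)
Definition tdist A z : R := fine (mine (edist_inf A z) 1%:E).

Lemma tdistE A z : (tdist A z)%:E = mine (edist_inf A z) 1%:E.
Proof.
rewrite /tdist fineK// fin_numE; apply/andP; split.
  by rewrite -ltNye lt_min ltNyr andbT ltNye.
by rewrite -ltey gt_min ltry orbT.
Qed.

Lemma tdist_ge0 A z : 0 <= tdist A z.
Proof. by rewrite -lee_fin tdistE le_min edist_inf_ge0 lee01. Qed.

Lemma tdist_continuous A : continuous (tdist A).
Proof.
move=> z; apply: fine_cvg; rewrite tdistE.
have cm := min_fun_continuous (@edist_inf_continuous R T A) (@cst_continuous T (\bar R) 1%:E).
by have := cm z.
Qed.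

Lemma tdist0 A z : A z -> tdist A z = 0.
Proof.
by move=> Az; apply: EFin_inj; rewrite tdistE edist_inf0//; apply/min_idPl.
Qed.

Lemma tdist_gt0 O z : open O -> O z -> 0 < tdist (~` O) z.
Proof.
move=> oO Oz.
have /nbhs_ballP[r /= r0 rO] : nbhs z O by apply: open_nbhs_nbhs.
have re : (r%:E <= edist_inf (~` O) z)%E.
  apply: le_ereal_inf_tmp => _ [a /= Oa <-]; rewrite leNgt; apply/negP => er.
  by apply: Oa; apply: rO; exact: (edist_lt_ball er).
by rewrite -lte_fin tdistE lt_min lte_fin ltr01 andbT (lt_le_trans _ re).
Qed.

(** For open [O], these continuous functions increase with [j] and at each point eventually equal
    the indicator of [O]. *)
Definition bump O (j : nat) z : R := Num.min (j%:R * tdist (~` O) z) 1.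

Lemma bump_continuous O j : continuous (bump O j).
Proof.
move=> z; apply: (@continuous_min R T (fun z => j%:R * tdist (~` O) z) (cst 1)).
  exact: continuousM (@cst_continuous _ _ _ _) (@tdist_continuous _ _).
exact: cst_continuous.
Qed.

Lemma bump_ge0 O j z : 0 <= bump O j z.
Proof. by rewrite le_min ler01 andbT mulr_ge0// tdist_ge0. Qed.

Lemma bump_le1 O j z : bump O j z <= 1.
Proof. by rewrite ge_min lexx orbT. Qed.

Lemma bump0 O j z : ~ O z -> bump O j z = 0.
Proof. by move=> Oz; rewrite /bump tdist0// mulr0; apply/min_idPl. Qed.

Lemma le_bump O i j z : (i <= j)%N -> bump O i z <= bump O j z.
Proof.
move=> ij; rewrite le_min [X in _ && X]ge_min lexx orbT andbT ge_min.
by apply/orP; left; rewrite ler_wpM2r ?tdist_ge0// ler_nat.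
Qed.

Lemma bump1 O z : open O -> O z -> exists j0, forall j, (j0 <= j)%N -> bump O j z = 1.
Proof.
move=> oO Oz; have d0 := tdist_gt0 oO Oz.
exists (Num.truncn (tdist (~` O) z)^-1).+1 => j jj.
apply/min_idPr; rewrite -ler_pdivrMr// div1r; apply/ltW.
by rewrite (lt_le_trans (Num.Theory.truncnS_gt _))// ler_nat.
Qed.

End dist_to_set.

Definition bcont {R : realType} {T : topologicalType} (f : T -> R) :=
  continuous f /\ exists M : R, forall z, `|f z| <= M.

Section bcont.
Context {R : realType} {T : topologicalType}.
Implicit Types f g : T -> R.

Lemma bcont_cst (c : R) : bcont (fun _ : T => c).
Proof. by split; [exact: cst_continuous | exists `|c|]. Qed.

Lemma bcontD f g : bcont f -> bcont g -> bcont (fun z => f z + g z).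
Proof.
move=> [cf [M fM]] [cg [N gN]]; split; last first.
  by exists (M + N) => z; rewrite (le_trans (ler_normD _ _))// lerD.
by move=> z; exact: (continuousD (cf z) (cg z)).
Qed.

Lemma bcontM f g : bcont f -> bcont g -> bcont (fun z => f z * g z).
Proof.
move=> [cf [M fM]] [cg [N gN]]; split; last first.
  by exists (M * N) => z; rewrite normrM ler_pM.
by move=> z; exact: (continuousM (cf z) (cg z)).
Qed.

Lemma bcontZ c f : bcont f -> bcont (fun z => c * f z).
Proof. exact/bcontM/bcont_cst. Qed.

Lemma bcontN f : bcont f -> bcont (fun z => - f z).
Proof. by move=> /(bcontZ (-1)); under eq_fun do rewrite mulN1r. Qed.

Lemma bcontB f g : bcont f -> bcont g -> bcont (fun z => f z - g z).
Proof. by move=> bf bg; apply: bcontD => //; exact: bcontN. Qed.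

Lemma bcont_min f g : bcont f -> bcont g -> bcont (fun z => Num.min (f z) (g z)).
Proof.
move=> [cf [M fM]] [cg [N gN]]; split; last first.
  exists (Num.max M N) => z; rewrite le_max.
  by have [_|_] := leP (f z) (g z); rewrite ?fM ?gN ?orbT.
by move=> z; exact: (continuous_min (cf z) (cg z)).
Qed.

Lemma bcont_max f g : bcont f -> bcont g -> bcont (fun z => Num.max (f z) (g z)).
Proof.
move=> [cf [M fM]] [cg [N gN]]; split; last first.
  exists (Num.max M N) => z; rewrite le_max.
  by have [_|_] := leP (f z) (g z); rewrite ?fM ?gN ?orbT.
by move=> z; exact: (continuous_max (cf z) (cg z)).
Qed.

Lemma bcont_sum (I : Type) (r : seq I) (f : I -> T -> R) :
  (forall i, bcont (f i)) -> bcont (fun z => \sum_(i <- r) f i z).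
Proof.
move=> bf; elim: r => [|i r IH].
  by under eq_fun do rewrite big_nil; exact: bcont_cst.
by under eq_fun do rewrite big_cons; exact: bcontD.
Qed.

End bcont.

Lemma bcont_bump {R : realType} {T : pseudoMetricType R} (O : set T) j :
  bcont (@bump R T O j).
Proof.
split; first exact: bump_continuous.
by exists 1 => z; rewrite ger0_norm ?bump_ge0 ?bump_le1.
Qed.

(** * Riesz representation on pseudometric spaces *)

(** The axioms of a normalized Daniell integral. Since the sequence in [daniell_cvg] decreases, a
    single index with a small value already expresses convergence to 0. *)
Record daniell {R : realType} {T : topologicalType} (L : (T -> R) -> R) : Prop := {
  daniellD : forall f g, bcont f -> bcont g -> L (fun z => f z + g z) = L f + L g ;
  daniellZ : forall c f, bcont f -> L (fun z => c * f z) = c * L f ;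
  daniell_ge0 : forall f, bcont f -> (forall z, 0 <= f z) -> 0 <= L f ;
  daniell1 : L (fun=> 1) = 1 ;
  daniell_cvg : forall f : nat -> T -> R, (forall k, bcont (f k)) ->
    (forall k z, 0 <= f k z) -> (forall k z, f k.+1 z <= f k z) ->
    (forall z e, 0 < e -> exists k, f k z < e) ->
    forall e, 0 < e -> exists k, L (f k) <= e }.

Section riesz.
Context {R : realType} {T : pseudoPMetricType R} (L : (T -> R) -> R).
Hypothesis dL : daniell L.
Implicit Types (f g : T -> R) (O : set T).

Lemma daniellB f g : bcont f -> bcont g -> L (fun z => f z - g z) = L f - L g.
Proof.
move=> bf bg; rewrite (daniellD dL bf (bcontN bg)).
have -> : (fun z => - g z) = (fun z => (-1) * g z) by apply/funext => z; rewrite mulN1r.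
by rewrite (daniellZ dL _ bg) mulN1r.
Qed.

Lemma le_daniell f g : bcont f -> bcont g -> (forall z, f z <= g z) -> L f <= L g.
Proof.
move=> bf bg fg; rewrite -subr_ge0 -daniellB//.
by apply: (daniell_ge0 dL); [exact: bcontB | move=> z; rewrite subr_ge0].
Qed.

Lemma daniell_sum (I : Type) (r : seq I) (f : I -> T -> R) : (forall i, bcont (f i)) ->
  L (fun z => \sum_(i <- r) f i z) = \sum_(i <- r) L (f i).
Proof.
move=> bf; elim: r => [|i r IH].
  rewrite big_nil; under eq_fun do rewrite big_nil.
  have -> : (fun=> 0) = (fun _ : T => 0 * 1 : R) by apply/funext => z; rewrite mul0r.
  by rewrite (daniellZ dL _ (bcont_cst 1)) mul0r.
rewrite big_cons; under eq_fun do rewrite big_cons.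
by rewrite (daniellD dL (bf i) (bcont_sum _ bf)) IH.
Qed.

Lemma daniell_cst c : L (fun=> c) = c.
Proof.
have -> : (fun=> c) = (fun _ : T => c * 1 : R) by apply/funext => z; rewrite mulr1.
by rewrite (daniellZ dL _ (bcont_cst 1)) (daniell1 dL) mulr1.
Qed.

Definition subind O f := [/\ bcont f, forall z, 0 <= f z, forall z, f z <= 1 &
  forall z, ~ O z -> f z = 0].

Lemma subind0 O : subind O (fun=> 0).
Proof. by split => //; exact: bcont_cst. Qed.

Lemma subind_bump O j : subind O (bump O j).
Proof.
split; [exact: bcont_bump|exact: bump_ge0|exact: bump_le1|].
by move=> z; exact: bump0.
Qed.

(** The first stage of the Riesz construction: open sets are measured from inside by continuous
    functions, and [outer_mass] then measures all sets from outside by open sets. *)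
Definition open_mass O : \bar R := ereal_sup [set (L f)%:E | f in subind O].

Lemma open_mass_ub O f : subind O f -> ((L f)%:E <= open_mass O)%E.
Proof. by move=> Of; apply: ereal_sup_ubound; exists f. Qed.

Lemma open_mass_ge0 O : (0 <= open_mass O)%E.
Proof. by apply: le_trans (open_mass_ub (subind0 O)); rewrite daniell_cst. Qed.

Lemma open_mass_le1 O : (open_mass O <= 1)%E.
Proof.
apply: ge_ereal_sup => _ [f [bf _ f1 _] <-]; rewrite lee_fin -[leRHS]daniell_cst.
by apply: le_daniell => //; exact: bcont_cst.
Qed.

Lemma open_mass_fin O : open_mass O \is a fin_num.
Proof.
by rewrite ge0_fin_numE ?open_mass_ge0// (le_lt_trans (open_mass_le1 O))// ltry.
Qed.

Lemma le_open_mass O O' : O `<=` O' -> (open_mass O <= open_mass O')%E.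
Proof.
move=> OO'; apply: ge_ereal_sup => _ [f [bf f0 f1 fO] <-]; apply: open_mass_ub.
by split => // z O'z; apply: fO => /OO'.
Qed.

Lemma open_mass_setT : open_mass setT = 1%E.
Proof.
apply/eqP; rewrite eq_le open_mass_le1/=.
have := @open_mass_ub setT (fun=> 1); rewrite daniell_cst; apply.
by split => //; [exact: bcont_cst | move=> z /(_ I)].
Qed.

Lemma open_mass_set0 : open_mass set0 = 0%E.
Proof.
apply/eqP; rewrite eq_le open_mass_ge0 andbT.
apply: ge_ereal_sup => _ [f [bf f0 f1 fO] <-].
have -> : f = fun=> 0 by apply/funext => z; exact: fO.
by rewrite daniell_cst.
Qed.

(** What remains of a test function [f] of the union after subtracting finitely many bumps decreases
    pointwise to 0. Daniell continuity then bounds [L f], up to [e], by a finite sum of values of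
    [L] on bumps. *)
Lemma open_mass_bigcup (O : nat -> set T) : (forall k, open (O k)) ->
  (open_mass (\bigcup_k O k) <= \sum_(0 <= k <oo) open_mass (O k))%E.
Proof.
move=> oO; apply: ge_ereal_sup => _ [f [bf f0 f1 fO] <-].
apply/lee_addgt0Pr => e e0.
(* [K] is both the number of sets and the sharpness of the bumps, so [s K] increases with [K] and is
   eventually at least 1 at each point of the union. *)
pose s K z : R := \sum_(0 <= i < K) bump (O i) K z.
have bs K : bcont (s K) by apply: bcont_sum => i; exact: bcont_bump.
pose h K z := Num.max (f z - s K z) 0.
have bh K : bcont (h K) by apply: bcont_max; [exact: bcontB|exact: bcont_cst].
have sS K z : s K z <= s K.+1 z.
  rewrite /s big_nat_recr//= -[leLHS]addr0 lerD ?bump_ge0//.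
  by apply: ler_sum => i _; exact: le_bump.
have [K hK] : exists K, L (h K) <= e.
  apply: (daniell_cvg dL) => //.
  - by move=> k z; rewrite le_max lexx orbT.
  - move=> k z; rewrite ge_max [0 <= h k z]le_max lexx orbT andbT le_max.
    by rewrite lerB.
  move=> z d d0; have [[k _ Okz]|/fO fz] := pselect ((\bigcup_k O k) z); last first.
    exists 0%N; rewrite gt_max d0 andbT fz.
    by rewrite /s big_nil subrr.
  have [j0 hj] := bump1 (oO k) Okz.
  pose K := maxn j0 k.+1.
  have kK : (k < K)%N by rewrite leq_max leqnn orbT.
  exists K; rewrite gt_max d0 andbT (le_lt_trans _ d0)// subr_le0.
  rewrite (le_trans (f1 z))// /s big_mkord (bigD1 (Ordinal kK))//=.
  rewrite hj ?leq_max ?leqnn// lerDl sumr_ge0// => i _.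
  exact: bump_ge0.
have : L f <= L (s K) + L (h K).
  rewrite -(daniellD dL)//; apply: le_daniell => //; first exact: bcontD.
  by move=> z; rewrite -lerBlDl le_max lexx.
rewrite -lee_fin => /le_trans; apply; rewrite EFinD leeD//.
rewrite /s daniell_sum ?sumEFin; last by move=> i; exact: bcont_bump.
rewrite (le_trans _ (nneseries_lim_ge K _))//; last first.
  by move=> *; exact: open_mass_ge0.
by rewrite -sumEFin; apply: lee_sum => i _; exact/open_mass_ub/subind_bump.
Qed.

Definition outer_mass (S : set T) : \bar R :=
  ereal_inf [set open_mass O | O in [set O | open O /\ S `<=` O]].

Lemma outer_mass_open O : open O -> outer_mass O = open_mass O.
Proof.
move=> oO; apply/eqP; rewrite eq_le; apply/andP; split.
  by apply: ereal_inf_lbound; exists O => //; split.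
by apply: le_ereal_inf_tmp => _ [G [_ OG] <-]; exact: le_open_mass.
Qed.

Lemma outer_mass_ge0 S : (0 <= outer_mass S)%E.
Proof. by apply: le_ereal_inf_tmp => _ [U _ <-]; exact: open_mass_ge0. Qed.

Lemma outer_mass0 : outer_mass set0 = 0%E.
Proof. by rewrite outer_mass_open ?open_mass_set0//; exact: open0. Qed.

Lemma le_outer_mass : {homo outer_mass : A B / A `<=` B >-> (A <= B)%E}.
Proof.
move=> A B AB; apply: le_ereal_inf_tmp => _ [U [oU BU] <-].
by apply: ereal_inf_lbound; exists U => //; split => //; exact: subset_trans BU.
Qed.

Lemma outer_mass_fin S : outer_mass S \is a fin_num.
Proof.
rewrite ge0_fin_numE ?outer_mass_ge0//.
apply: (@le_lt_trans _ _ (outer_mass setT)); first exact: le_outer_mass.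
by rewrite outer_mass_open ?open_mass_setT ?ltry//; exact: openT.
Qed.

Lemma outer_mass_adherent S (e : R) : 0 < e ->
  exists O, [/\ open O, S `<=` O & (open_mass O <= outer_mass S + e%:E)%E].
Proof.
move=> e0; have [_ [U [oU SU] <-] /ltW h] := lb_ereal_inf_adherent e0 (outer_mass_fin S).
by exists U.
Qed.

Lemma outer_mass_sigma_subadditive : sigma_subadditive outer_mass.
Proof.
move=> A; apply/lee_addgt0Pr => e e0.
apply: le_trans (epsilon_trick _ _ (ltW e0)); last by move=> n; exact: outer_mass_ge0.
have /choice[U hU] : forall n, exists O, [/\ open O, A n `<=` O &
    (open_mass O <= outer_mass (A n) + (e / (2 ^ n.+1)%:R)%:E)%E].
  by move=> n; apply: outer_mass_adherent; rewrite divr_gt0// ltr0n expn_gt0.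
have oU n : open (U n) by have [] := hU n.
apply: (@le_trans _ _ (outer_mass (\bigcup_n U n))).
  by apply/le_outer_mass/subset_bigcup => n _; have [] := hU n.
rewrite outer_mass_open; last exact: bigcup_open.
apply: (le_trans (open_mass_bigcup oU)); apply: lee_nneseries => n _.
  by rewrite open_mass_ge0.
by have [] := hU n.
Qed.

HB.instance Definition _ := isOuterMeasure.Build R T outer_mass
  outer_mass0 outer_mass_ge0 le_outer_mass outer_mass_sigma_subadditive.

(* If f is close to optimal for U `&` G and g for U `&` {f < d}, then (f - d)^+ + g is still below
   the indicator of U, which bounds the sum of the two masses by that of U. *)
Lemma open_caratheodory G : open G -> outer_mass.-caratheodory G.
Proof.
move=> oG; apply: le_caratheodory_measurable => S.
apply/lee_addgt0Pr => e e0.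
have e4 : 0 < e / 4 by rewrite divr_gt0.
have [U [oU SU hU]] := outer_mass_adherent S e4.
have oOG := openI oU oG.
have [_ [f [bf f0 f1 fOG] <-] hf] := ub_ereal_sup_adherent e4 (open_mass_fin (U `&` G)).
pose d := e / 4.
pose f' z := Num.max (f z - d) 0.
have bf' : bcont f'.
  by apply: bcont_max; [apply: bcontB => //; exact: bcont_cst|exact: bcont_cst].
pose O' := U `&` [set z | f z < d].
have oO' : open O'.
  apply: openI => //; apply: (@open_comp _ _ f [set x | x < d]); last exact: open_lt.
  by move=> z _; exact: bf.1.
have [_ [g [bg g0 g1 gO'] <-] hg] := ub_ereal_sup_adherent e4 (open_mass_fin O').
have Lff' : L f <= L f' + d.
  rewrite -[X in _ + X](daniell_cst d) -(daniellD dL)//; last exact: bcont_cst.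
  apply: le_daniell => //; first by apply: bcontD => //; exact: bcont_cst.
  by move=> z; rewrite /f' -lerBlDr le_max lexx.
have sfg : subind U (fun z => f' z + g z).
  split; first exact: bcontD.
  - by move=> z; rewrite addr_ge0// le_max lexx orbT.
  - move=> z; have [fz|fz] := ltP (f z) d.
      rewrite /f' (max_idPr _) ?add0r//.
      by rewrite subr_le0 ltW.
    rewrite gO' ?addr0; last by move=> [_ /=]; rewrite ltNge fz.
    rewrite ge_max ler01 andbT lerBlDr (le_trans (f1 z))// lerDl ltW//.
  - move=> z Oz; rewrite gO' ?addr0; last by case.
    rewrite /f' fOG; last by case.
    by apply/max_idPr; rewrite sub0r oppr_le0 ltW.
have h1 : (outer_mass (S `&` G) <= (L f)%:E + (e / 4)%:E)%E.
  apply: (@le_trans _ _ (outer_mass (U `&` G))).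
    by apply: le_outer_mass; exact: setSI.
  by rewrite outer_mass_open// -leeBlDr// ltW.
have h2 : (outer_mass (S `&` ~` G) <= (L g)%:E + (e / 4)%:E)%E.
  apply: (@le_trans _ _ (outer_mass O')).
    apply: le_outer_mass => z [/SU Oz nGz]; split => //=.
    by rewrite fOG// => -[].
  by rewrite outer_mass_open// -leeBlDr// ltW.
have h3 := open_mass_ub sfg.
rewrite (daniellD dL bf' bg) in h3.
rewrite -[leLHS]/(outer_mass (S `&` G) + outer_mass (S `&` ~` G))%E.
rewrite -[X in (_ <= X + _)%E]/(outer_mass S).
have aux (a b c l l' k q : R) : a <= l + q -> b <= k + q -> l' + k <= c + q ->
  l <= l' + q -> a + b <= c + 4 * q by lra.
have e4E : 4 * (e / 4) = e by rewrite mulrC divfK.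
move: (le_trans h3 hU) h1 h2 => {h3 hU}.
rewrite -(fineK (outer_mass_fin S)) -(fineK (outer_mass_fin (S `&` G))).
rewrite -(fineK (outer_mass_fin (S `&` ~` G))) -!EFinD !lee_fin.
by move=> h3 h1 h2; have := aux _ _ _ _ _ _ _ h1 h2 h3 Lff'; rewrite e4E.
Qed.

Lemma sub_caratheodory_borel (A : set (borel T)) : measurable A -> outer_mass.-caratheodory A.
Proof.
apply: smallest_sub; last by move=> G; exact: open_caratheodory.
split.
- exact: caratheodory_measurable_set0.
- by move=> B mB; rewrite setTD; exact: caratheodory_measurable_setC.
- by move=> F mF; exact: caratheodory_measurable_bigcup.
Qed.

(** [outer_mass] restated on the carrier [borel T], to which the structures of measure and
    probability on Borel sets are attached. *)
Definition riesz_measure (A : set (borel T)) : \bar R := outer_mass A.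

Let riesz_measure0 : riesz_measure set0 = 0%E. Proof. exact: outer_mass0. Qed.

Let riesz_measure_ge0 A : (0 <= riesz_measure A)%E. Proof. exact: outer_mass_ge0. Qed.

Let riesz_measure_sigma_additive : semi_sigma_additive riesz_measure.
Proof.
move=> F mF tF mUF; apply: (@caratheodory_measure_sigma_additive _ _ outer_mass) => //.
- by move=> i; exact: sub_caratheodory_borel.
- exact: sub_caratheodory_borel.
Qed.

HB.instance Definition _ := isMeasure.Build _ _ _ riesz_measure
  riesz_measure0 riesz_measure_ge0 riesz_measure_sigma_additive.

Let riesz_measureT : riesz_measure setT = 1%E.
Proof. by rewrite /riesz_measure outer_mass_open ?open_mass_setT//; exact: openT. Qed.

HB.instance Definition _ := Measure_isProbability.Build _ _ _ riesz_measure riesz_measureT.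

Lemma bcont_bmeas f : bcont f -> bmeas (f : borel T -> R).
Proof.
move=> [cf bf]; split => //.
apply: (measurability _ (@RGenOpens.measurableE R)) => _ [_ [a [b ->] <-]].
rewrite setTI; apply: sub_sigma_algebra.
by apply: open_comp => [z _|]; [exact: cf|exact: interval_open].
Qed.

(** Cut [N * f] into continuous layers. The [j]-th one is a test function for the open set where
    [j < N * f], so [L] of it is at most the mass of that set; these indicators add up to at most
    [N * f + 1]. Division by [N] leaves an error below [e]. *)
Lemma riesz_le_half f : bcont f -> (forall z, 0 <= f z) -> (forall z, f z <= 1) ->
  L f <= \int[riesz_measure]_z f z.
Proof.
move=> bf f0 f1; apply/ler_addgt0Pr => e e0.
pose N := (Num.truncn e^-1).+1.
have eN : e^-1 < N%:R by exact: Num.Theory.truncnS_gt.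
have Nf0 z : 0 <= N%:R * f z by rewrite mulr_ge0.
have NfN z : N%:R * f z <= N%:R by rewrite ler_piMr.
have bl j : bcont (fun z => layer j (N%:R * f z)).
  apply: bcont_min; last exact: bcont_cst.
  apply: bcont_max; last exact: bcont_cst.
  by apply: bcontB; [exact: bcontZ|exact: bcont_cst].
pose O j := [set z | j%:R < N%:R * f z].
have oO j : open (O j).
  apply: (@open_comp _ _ (fun z => N%:R * f z) [set x | j%:R < x]); last exact: open_gt.
  by move=> z _; exact: (bcontZ N%:R bf).1.
have mO j : measurable (O j : set (borel T)) by exact: sub_sigma_algebra.
have h1 : N%:R * L f <= \sum_(0 <= j < N) fine (riesz_measure (O j)).
  rewrite -(daniellZ dL)//.
  have -> : (fun z => N%:R * f z) = (fun z => \sum_(0 <= j < N) layer j (N%:R * f z)).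
    by apply/funext => z; rewrite sum_layer.
  rewrite daniell_sum//; apply: ler_sum => j _.
  rewrite -lee_fin fineK ?outer_mass_fin// /riesz_measure outer_mass_open//; apply: open_mass_ub.
  split => // [z|z|z /negP]; [exact: layer_ge0|exact: layer_le1|].
  by rewrite -leNgt => /layer0.
have h2 : \sum_(0 <= j < N) fine (riesz_measure (O j)) <=
    N%:R * \int[riesz_measure]_z f z + 1.
  under eq_bigr do rewrite -(Rint_indic riesz_measure)//.
  rewrite -Rint_sum; last by move=> j; exact: bmeas_indic.
  have -> : N%:R * \int[riesz_measure]_z f z + 1 = \int[riesz_measure]_z (N%:R * f z + 1).
    rewrite RintD ?RintZ ?Rint_cst//; [exact: bcont_bmeas|exact/bmeasZ/bcont_bmeas|].
    exact: bmeas_cst.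
  apply: le_Rint; first by apply: bmeas_sum => j; exact: bmeas_indic.
    by apply: bmeasD; [exact/bmeasZ/bcont_bmeas|exact: bmeas_cst].
  move=> z; apply: (le_trans _ (layers_le (Nf0 z) (NfN z))).
  apply: ler_sum => j _; rewrite indicE.
  by have [/[!inE] /= ->|] := boolP (z \in O j).
have : 1 <= N%:R * e by rewrite -ler_pdivrMr// div1r ltW.
have N0 : 0 < N%:R :> R by [].
move: h1 h2; set a := L f; set b := \int[_]_z _; set c := \sum_(_ <= _ < _) _ => h1 h2 h3.
by rewrite -(ler_pM2l N0) mulrDr (le_trans h1)// (le_trans h2)// lerD2l.
Qed.

(** The affine map from [[-K, K]] onto [[0, 1]] reduces this to the previous case, both sides being
    compatible with affine maps. *)
Lemma riesz_le f : bcont f -> L f <= \int[riesz_measure]_z f z.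
Proof.
move=> bf; have [cf [M fM]] := bf.
pose K := `|M| + 1; have K0 : 0 < K by rewrite ltr_wpDl.
have K20 : 0 < 2 * K by rewrite mulr_gt0.
have fK z : - K <= f z <= K.
  by rewrite -ler_norml (le_trans (fM z))// (le_trans (ler_norm _))// lerDl.
pose g z := (2 * K)^-1 * (f z + K).
have bfK : bcont (fun z => f z + K) by apply: bcontD => //; exact: bcont_cst.
have bg : bcont g by exact: bcontZ.
have g0 z : 0 <= g z.
  rewrite mulr_ge0 ?invr_ge0 ?(ltW K20)//.
  by have /andP[+ _] := fK z; rewrite lerNl -subr_ge0 opprK addrC.
have g1 z : g z <= 1.
  rewrite /g mulrC ler_pdivrMr// mul1r mulr2n mulrDl mul1r lerD2r.
  by have /andP[] := fK z.
have := riesz_le_half bg g0 g1.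
rewrite (daniellZ dL)// (daniellD dL)//; last exact: bcont_cst.
have -> : \int[riesz_measure]_z g z = (2 * K)^-1 * (\int[riesz_measure]_z f z + K).
  rewrite RintZ; last exact: bcont_bmeas bfK.
  by rewrite RintD ?Rint_cst//; [exact: bcont_bmeas bf|exact: bmeas_cst].
by rewrite daniell_cst ler_pM2l ?invr_gt0// lerD2r.
Qed.

(** The inequality of [riesz_le] for [- f] is the reverse inequality for [f]. *)
Lemma riesz : exists m : probability (borel T) R,
  forall f, bcont f -> \int[m]_z f z = L f.
Proof.
exists riesz_measure => f bf; apply/eqP; rewrite eq_le riesz_le// andbT.
have := riesz_le (bcontN bf); have bf' := bcont_bmeas bf.
have -> : (fun z => - f z) = (fun z => (-1) * f z) by apply/funext => z; rewrite mulN1r.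
by rewrite (daniellZ dL _ bf) RintZ// !mulN1r lerN2.
Qed.
End riesz.

(** * Positive functionals on bounded measurable functions *)

(** Rescale the range of [f] from [[-K, K]] to [[0, N]] and count superlevel sets. The rounding
    error 1 becomes [2 * K / N] on the original scale, which the choice of [N] makes at most [e]. *)
Lemma bmeas_approx {R : realType} d {T : measurableType d} (f : T -> R) (e : R) :
  bmeas f -> 0 < e -> exists (N : nat) (a b : R) (E : nat -> set T),
    (forall j, measurable (E j)) /\
    forall x, `|f x - (b + a * \sum_(0 <= j < N) \1_(E j) x)| <= e.
Proof.
move=> bf e0; have [mf [M fM]] := bf.
pose K := `|M| + 1; have K0 : 0 < K by rewrite ltr_wpDl.
have K20 : 0 < 2 * K by rewrite mulr_gt0.
have fK z : - K <= f z <= K.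
  by rewrite -ler_norml (le_trans (fM z))// (le_trans (ler_norm _))// lerDl.
pose N := (Num.truncn (2 * K / e)).+1.
have N0 : 0 < N%:R :> R by [].
have NK : 2 * K / N%:R <= e.
  rewrite ler_pdivrMr// [leRHS]mulrC -ler_pdivrMr//.
  by apply: ltW; exact: Num.Theory.truncnS_gt.
pose g z := N%:R / (2 * K) * (f z + K).
have c0 : 0 < N%:R / (2 * K) by rewrite divr_gt0.
have g0 z : 0 <= g z.
  rewrite mulr_ge0 ?(ltW c0)//.
  by have /andP[+ _] := fK z; rewrite lerNl -subr_ge0 opprK addrC.
have gN z : g z <= N%:R.
  rewrite /g -mulrA ger_pMr// mulrC ler_pdivrMr// mul1r mulr2n mulrDl mul1r lerD2r.
  by have /andP[] := fK z.
exists N, (2 * K / N%:R), (- K), (fun j => [set x | j%:R < g x]); split.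
  move=> j; rewrite -[X in measurable X]setTI.
  have [mg _] : bmeas g by apply/bmeasZ/bmeasD => //; exact: bmeas_cst.
  have -> : [set x | j%:R < g x] = g @^-1` `]j%:R, +oo[%classic.
    by apply/seteqP; split => x /=; rewrite in_itv/= andbT.
  exact: mg.
move=> x.
have -> : \sum_(0 <= j < N) \1_[set x0 | j%:R < g x0] x = layers N (g x).
  apply: eq_bigr => j _; rewrite indicE; congr (nat_of_bool _)%:R.
  by apply/idP/idP; rewrite inE.
have -> : f x = - K + 2 * K / N%:R * g x.
  rewrite /g mulrA [X in X * _](_ : _ = 1); first by rewrite mul1r addrC addrK.
  by rewrite mulrA divfK ?gt_eqF// divff// gt_eqF.
have a0 : 0 < 2 * K / N%:R by rewrite divr_gt0.
rewrite [X in `|X|](_ : _ = 2 * K / N%:R * (g x - layers N (g x))); last by ring.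
rewrite normrM gtr0_norm//.
rewrite (le_trans _ NK)// ger_pMr// distrC ler_norml.
have h1 := layers_ge (g0 x) (gN x); have h2 := layers_le (g0 x) (gN x).
by rewrite lerBlDl h2 andbT (@le_trans _ _ 0) ?lerN10// subr_ge0.
Qed.

(** No monotone continuity is asked: uniform approximation by simple functions already makes such a
    functional determined by its values on indicators. *)
Record posfun {R : realType} d {T : measurableType d} (L : (T -> R) -> R) : Prop := {
  posfunD : forall f g, bmeas f -> bmeas g -> L (fun z => f z + g z) = L f + L g ;
  posfunZ : forall c f, bmeas f -> L (fun z => c * f z) = c * L f ;
  posfun_ge0 : forall f, bmeas f -> (forall z, 0 <= f z) -> 0 <= L f }.

Section posfun.
Context {R : realType} d {T : measurableType d}.
Implicit Types (L : (T -> R) -> R) (f g : T -> R).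

Lemma le_posfun L f g : posfun L -> bmeas f -> bmeas g -> (forall x, f x <= g x) ->
  L f <= L g.
Proof.
move=> pL bf bg fg.
have -> : g = fun x => f x + (g x - f x) by apply/funext => x; rewrite addrC subrK.
rewrite (posfunD pL)//; last exact: bmeasB.
by rewrite lerDl (posfun_ge0 pL)//; [exact: bmeasB|move=> x; rewrite subr_ge0].
Qed.

Lemma posfun_cst L c : posfun L -> L (fun=> c) = c * L (fun=> 1).
Proof.
move=> pL; rewrite -(posfunZ pL); last exact: bmeas_cst.
by congr L; apply/funext => x; rewrite mulr1.
Qed.

Lemma posfun_sum L (I : Type) (r : seq I) (f : I -> T -> R) :
  posfun L -> (forall i, bmeas (f i)) ->
  L (fun z => \sum_(i <- r) f i z) = \sum_(i <- r) L (f i).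
Proof.
move=> pL bf; elim: r => [|i r IH].
  by rewrite big_nil; under eq_fun do rewrite big_nil; rewrite posfun_cst// mul0r.
rewrite big_cons; under eq_fun do rewrite big_cons.
by rewrite (posfunD pL (bf i) (bmeas_sum _ bf)) IH.
Qed.

Lemma posfun_close L f g e : posfun L -> bmeas f -> bmeas g ->
  (forall x, `|f x - g x| <= e) -> `|L f - L g| <= e * L (fun=> 1).
Proof.
move=> pL bf bg fg; rewrite -posfun_cst// ler_norml.
have h x := ler_normlP _ _ (fg x).
have be := bmeas_cst (T := T) e.
apply/andP; split.
  rewrite lerBrDl lerBlDr -(posfunD pL)// le_posfun//; first exact: bmeasD.
  by move=> x; have [+ _] := h x; rewrite opprB lerBlDl.
rewrite lerBlDl -(posfunD pL)// le_posfun//; first exact: bmeasD.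
by move=> x; have [_] := h x; rewrite lerBlDl.
Qed.

Lemma posfun_Rint (m : probability T R) : posfun (fun f => \int[m]_x f x).
Proof.
split => [f g|c f|f]; [exact: RintD|exact: RintZ|by move=> _; exact: Rint_ge0].
Qed.

Lemma posfun_simple L N a b (E : nat -> set T) : posfun L -> (forall j, measurable (E j)) ->
  L (fun x => b + a * \sum_(0 <= j < N) \1_(E j) x) =
  b * L (fun=> 1) + a * \sum_(0 <= j < N) L (\1_(E j)).
Proof.
move=> pL mE; have bE j := bmeas_indic (mE j).
rewrite (posfunD pL); [|exact: bmeas_cst|exact/bmeasZ/bmeas_sum].
rewrite posfun_cst// (posfunZ pL); last exact: bmeas_sum.
by rewrite posfun_sum.
Qed.

Lemma bmeas_simple N (a b : R) (E : nat -> set T) : (forall j, measurable (E j)) ->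
  bmeas (fun x => b + a * \sum_(0 <= j < N) \1_(E j) x).
Proof.
move=> mE; apply: bmeasD; first exact: bmeas_cst.
by apply/bmeasZ/bmeas_sum => j; exact: bmeas_indic.
Qed.

(** Both functionals agree on simple functions, and a uniform error [c] changes each of them by at
    most [c * L 1]. *)
Lemma posfun_eq L L' : posfun L -> posfun L' ->
  (forall E, measurable E -> L (\1_E) = L' (\1_E)) ->
  forall f, bmeas f -> L f = L' f.
Proof.
move=> pL pL' LL' f bf; apply/eqP; rewrite -subr_eq0 -normr_le0.
have LT : L (fun=> 1) = L' (fun=> 1).
  have <- : \1_setT = (fun=> 1) :> (T -> R) by rewrite indicT.
  exact: LL'.
have L1 : 0 <= L (fun=> 1) by apply: (posfun_ge0 pL) => //; exact: bmeas_cst.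
apply/ler_addgt0Pr => e e0; rewrite add0r.
(* Two errors [c * L 1] must fit in [e]; the added 1 avoids division by zero when [L 1 = 0]. *)
pose c := e / (2 * (L (fun=> 1) + 1)).
have L10 : 0 < L (fun=> 1) + 1 by rewrite ltr_wpDl.
have c0 : 0 < c by rewrite divr_gt0// mulr_gt0.
have [N [a [b [E [mE fE]]]]] := bmeas_approx bf c0.
have bs := bmeas_simple N a b mE.
set s := (fun x => _) in bs.
have ss : L s = L' s.
  by rewrite !posfun_simple// LT; congr (_ + _ * _); apply: eq_bigr => j _; exact: LL'.
rewrite -[X in `|X|](subrKA (L s)) {2}ss (le_trans (ler_normD _ _))//.
rewrite [X in _ + X]distrC.
apply: (le_trans (lerD (posfun_close pL bf bs fE) (posfun_close pL' bf bs fE))).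
rewrite -LT -mulrDr -mulr2n /c -mulrA ger_pMr// mulrC ler_pdivrMr ?mulr_gt0//.
by rewrite mul1r mulr_natl ler_wMn2r// lerDl.
Qed.

(** Normalization makes the uniform approximation error the same for every [L i], so convergence on
    indicators extends to bounded measurable functions by a three-epsilon argument. *)
Lemma posfun_cvg (I : Type) (F : set_system I) (L : I -> (T -> R) -> R)
  (L' : (T -> R) -> R) : Filter F ->
  (forall i, posfun (L i)) -> (forall i, L i (fun=> 1) = 1) ->
  posfun L' -> (forall E, measurable E -> L i (\1_E) @[i --> F] --> L' (\1_E)) ->
  L' (fun=> 1) = 1 ->
  forall f, bmeas f -> L i f @[i --> F] --> L' f.
Proof.
move=> FF pL L1 pL' LL' L'1 f bf; apply/cvgrPdist_le => e e0.
have e3 : 0 < e / 3 by rewrite divr_gt0.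
have [N [a [b [E [mE fE]]]]] := bmeas_approx bf e3.
have bs := bmeas_simple N a b mE.
set s := (fun x => _) in bs.
have cs : L i s @[i --> F] --> L' s.
  rewrite posfun_simple//; under eq_fun do rewrite posfun_simple// L1.
  rewrite L'1; apply: cvgD; first exact: cvg_cst.
  by apply: cvgMr; apply: cvg_big => [|j _]; [exact: add_continuous|exact: LL'].
have /cvgrPdist_le/(_ _ e3) := cs; apply: filterS => i h.
have h1 := posfun_close pL' bf bs fE; have h2 := posfun_close (pL i) bf bs fE.
rewrite L'1 mulr1 in h1; rewrite L1 mulr1 in h2.
have -> : L' f - L i f = (L' f - L' s) + (L' s - L i s) - (L i f - L i s) by ring.
have -> : e = e / 3 + e / 3 + e / 3 by field.
by rewrite (le_trans (ler_normB _ _))// lerD// (le_trans (ler_normD _ _))// lerD.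
Qed.

End posfun.

(** * Exponential estimates for i.i.d. samples *)

Section iid.
Context {R : realType} dO (Om : measurableType dO) (P : probability Om R)
  (T : ptopologicalType) (Ws : nat -> Om -> borel T) (lam0 : probability (borel T) R).
Hypothesis Ws_iid : iid_law P Ws lam0.

Lemma bmeas_Ws i (f : borel T -> R) : bmeas f -> bmeas (fun om => f (Ws i om)).
Proof. by apply: bmeas_comp; exact: Ws_iid.1. Qed.

(* By induction on the number of factors that are not indicators: both sides are positive
   functionals of the new factor, and they agree on indicators. *)
Lemma iid_prod n (h : 'I_n -> borel T -> R) :
  (forall i, bmeas (h i)) -> (forall i x, 0 <= h i x) ->
  \int[P]_om \prod_(i < n) h i (Ws i om) = \prod_(i < n) \int[lam0]_x h i x.
Proof.
suff key k : (k <= n)%N -> forall h : 'I_n -> borel T -> R,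
    (forall i, bmeas (h i)) -> (forall i x, 0 <= h i x) ->
    (forall i : 'I_n, (k <= i)%N -> exists E, measurable E /\ h i = \1_E) ->
    \int[P]_om \prod_(i < n) h i (Ws i om) = \prod_(i < n) \int[lam0]_x h i x.
  by move=> bh h0; apply: (key n) => // i; rewrite leqNgt ltn_ord.
elim: k => [_|k IH kn] {}h bh h0 hE.
  have /choice[E hE'] : forall i, exists E, measurable E /\ h i = \1_E by move=> i; exact: hE.
  have mE i : measurable (E i) by have [] := hE' i.
  have -> : (fun om => \prod_(i < n) h i (Ws i om)) =
      \1_(\bigcap_(i in [set: 'I_n]) (Ws i @^-1` E i)).
    apply/funext => om; rewrite indicE.
    have [/[!inE] om1|om0] := boolP (om \in _).
      rewrite big1// => i _; have [_ ->] := hE' i.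
      by rewrite indicE mem_set//; exact: om1.
    have [i Ei] : exists i : 'I_n, ~ E i (Ws i om).
      apply/not_existsP => H; move/negP: om0; apply; rewrite inE => i _.
      by apply: contrapT => /(H i).
    by rewrite (bigD1 i)//=; have [_ ->] := hE' i; rewrite indicE memNset// mul0r.
  rewrite Rint_indic; last first.
    apply: fin_bigcap_measurable => // i _.
    by rewrite -[X in measurable X]setTI; exact: Ws_iid.1.
  rewrite Ws_iid.2//.
  have -> : (\prod_(i < n) lam0 (E i) = (\prod_(i < n) \int[lam0]_x h i x)%:E)%E.
    elim/big_ind2 : _ => //; first by move=> x y x' y' -> ->; rewrite EFinM.
    move=> i _; have [_ ->] := hE' i.
    by rewrite Rint_indic// fineK// fin_num_measure.
  by [].
pose i0 := Ordinal kn.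
pose G om := \prod_(i < n | i != i0) h i (Ws i om).
have bG : bmeas G.
  rewrite /G; under eq_fun do rewrite -big_filter.
  by apply: bmeas_prod => i; exact: bmeas_Ws.
have G0 om : 0 <= G om by apply: prodr_ge0.
pose c := \prod_(i < n | i != i0) \int[lam0]_x h i x.
have c0 : 0 <= c by apply: prodr_ge0 => i _; exact: Rint_ge0.
pose L (f : borel T -> R) := \int[P]_om (f (Ws i0 om) * G om).
pose L' (f : borel T -> R) := c * \int[lam0]_x f x.
have bfG (f : borel T -> R) : bmeas f -> bmeas (fun om => f (Ws i0 om) * G om).
  by move=> bf; apply: bmeasM => //; exact: bmeas_Ws.
have pL : posfun L.
  split.
  - move=> f g bf bg; rewrite /L -RintD; [|exact: bfG..].
    by apply: eq_Rintegral => om _; rewrite mulrDl.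
  - move=> a f bf; rewrite /L -RintZ; last exact: bfG.
    by apply: eq_Rintegral => om _; rewrite mulrA.
  - by move=> f bf f0; apply: Rint_ge0 => om; rewrite mulr_ge0.
have pL' : posfun L'.
  split.
  - by move=> f g bf bg; rewrite /L' RintD// mulrDr.
  - by move=> a f bf; rewrite /L' RintZ// mulrCA.
  - by move=> f bf f0; rewrite mulr_ge0// Rint_ge0.
have LL' E : measurable E -> L (\1_E) = L' (\1_E).
  move=> mE; pose h' i := if i == i0 then \1_E else h i.
  have h'0 : h' i0 = \1_E by rewrite /h' eqxx.
  have h'n i : i != i0 -> h' i = h i by rewrite /h' => /negbTE ->.
  have e1 : L (\1_E) = \int[P]_om \prod_(i < n) h' i (Ws i om).
    apply: eq_Rintegral => om _; rewrite [RHS](bigD1 i0)//= h'0; congr (_ * _).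
    by apply: eq_bigr => i /h'n ->.
  have e2 : \prod_(i < n) \int[lam0]_x h' i x = L' (\1_E).
    rewrite (bigD1 i0)//= h'0 mulrC; congr (_ * _).
    by apply: eq_bigr => i /h'n ->.
  rewrite e1 -e2; apply: IH (ltnW kn) _ _ _ _.
  - by move=> i; rewrite /h'; case: ifPn => // _; exact: bmeas_indic.
  - by move=> i x; rewrite /h'; case: ifPn => // _; rewrite indicE.
  - move=> i; rewrite leq_eqVlt => /predU1P[ki|ki].
      by exists E; split => //; rewrite /h' (_ : i == i0)//; apply/eqP/val_inj.
    rewrite h'n; first exact: hE.
    by apply: contraTneq ki => ->; rewrite ltnn.
have := posfun_eq pL pL' LL' (bh i0); rewrite /L /L' => H.
rewrite (bigD1 i0)//= mulrC -/c -H.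
by apply: eq_Rintegral => om _; rewrite (bigD1 i0).
Qed.

Lemma iid_expect n (h : borel T -> R) : bmeas h -> (forall x, 0 <= h x) ->
  \int[P]_om \prod_(i < n) h (Ws i om) = (\int[lam0]_x h x) ^+ n.
Proof.
by move=> bh h0; rewrite (@iid_prod n (fun=> h))// prodr_const card_ord.
Qed.

End iid.

Lemma measurable_ge0 {R : realType} d {T : measurableType d} (f : T -> R) :
  bmeas f -> measurable [set x | 0 <= f x].
Proof.
move=> [mf _]; rewrite -[X in measurable X]setTI.
have -> : [set x | 0 <= f x] = f @^-1` `[0, +oo[%classic.
  by apply/seteqP; split => x /=; rewrite in_itv/= andbT.
exact: mf.
Qed.

(** The exponential is at most [1 / (1 - x)], and [(1 - x) * (1 + x + 2 * x ^+ 2) = 1 + x ^+ 2 * (1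
    - 2 * x)] is at least 1. *)
Lemma expR_le_quad {R : realType} (x : R) : `|x| <= 2^-1 -> expR x <= 1 + x + 2 * x ^+ 2.
Proof.
rewrite ler_norml => /andP[x1 x2].
have h : 1 - x <= expR (- x) by exact: expR_ge1Dx.
have x0 : 0 < 1 - x by lra.
have -> : expR x = (expR (- x))^-1 by rewrite expRN invrK.
apply: (@le_trans _ _ (1 - x)^-1); first by rewrite lef_pV2// posrE expR_gt0.
rewrite -div1r ler_pdivrMr//; nra.
Qed.

(** * Exponential Chebyshev bounds and change of measure *)

Section chernoff.
Context {R : realType} dO (Om : measurableType dO) (P : probability Om R)
  (T : ptopologicalType) (Ws : nat -> Om -> borel T) (lam0 : probability (borel T) R).
Hypothesis Ws_iid : iid_law P Ws lam0.
Implicit Types (u h : borel T -> R).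

Definition wsum u n om := \sum_(i < n) u (Ws i om).

Lemma bmeas_wsum u n : bmeas u -> bmeas (wsum u n).
Proof. by move=> bu; apply: bmeas_sum => i; exact: (bmeas_Ws Ws_iid). Qed.

Lemma bmeas_wprod h n : bmeas h -> bmeas (fun om => \prod_(i < n) h (Ws i om)).
Proof. by move=> bh; apply: bmeas_prod => i; exact: (bmeas_Ws Ws_iid). Qed.

(** Common form of the deviation events: thresholds are absorbed in [u], and the event is unlikely
    under a tilt for which [u] has negative mean. *)
Definition wbad u n := [set om | 0 <= wsum u n om].

Lemma measurable_wbad u n : bmeas u -> measurable (wbad u n).
Proof. by move=> bu; exact/measurable_ge0/bmeas_wsum. Qed.

(** On [wbad u n] the indicator is at most the exponential of the sum of [u], which factorizes by
    independence. The weight [h] allows the bound to be used under a tilted law; [h = 1] is the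
    untilted case. *)
Lemma iid_markov u h n : bmeas u -> bmeas h -> (forall x, 0 <= h x) ->
  \int[P]_om (\1_(wbad u n) om * \prod_(i < n) h (Ws i om)) <=
  (\int[lam0]_x (h x * expR (u x))) ^+ n.
Proof.
move=> bu bh h0; have bhu : bmeas (fun x => h x * expR (u x)).
  by apply: bmeasM => //; exact: bmeas_expR.
rewrite -(iid_expect Ws_iid)//; last by move=> x; rewrite mulr_ge0// expR_ge0.
apply: le_Rint.
- by apply: bmeasM; [exact/bmeas_indic/measurable_wbad|exact: bmeas_wprod].
- exact: (bmeas_wprod n bhu).
move=> om; have p0 : 0 <= \prod_(i < n) h (Ws i om) by apply: prodr_ge0.
rewrite big_split/= -expR_sum indicE.
have [/[!inE] omS|_] := boolP (om \in _); last first.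
  by rewrite mul0r mulr_ge0// expR_ge0.
by rewrite mulrC ler_wpM2l// -expR0 ler_expR.
Qed.

Lemma Rint_expR_gt0 u : bmeas u -> 0 < \int[lam0]_x expR (u x).
Proof.
move=> bu; have [_ [M uM]] := bu.
apply: (@lt_le_trans _ _ (\int[lam0]_(x in setT) expR (- M))).
  by rewrite Rint_cst expR_gt0.
apply: le_Rint; [exact: bmeas_cst|exact: bmeas_expR|].
by move=> x; rewrite ler_expR; have := uM x; rewrite ler_norml => /andP[].
Qed.

Lemma iid_chernoff u r n : bmeas u ->
  (P [set om | (n%:R * (r + ln (\int[lam0]_x expR (u x))) <= wsum u n om)%R] <=
   (expR (- (n%:R * r)))%:E)%E.
Proof.
move=> bu; have Z0 := Rint_expR_gt0 bu; set Z := \int[lam0]_x _ in Z0 *.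
(* The shift makes the exponential moment of [v] exactly [expR (- r)]. *)
pose v x := u x - (r + ln Z).
have bv : bmeas v by apply: bmeasB => //; exact: bmeas_cst.
have -> : [set om | n%:R * (r + ln Z) <= wsum u n om] = wbad v n.
  apply/seteqP; split => om /=; rewrite /wbad/= /wsum /v sumrB sumr_const card_ord;
  by rewrite subr_ge0 mulr_natl.
have mS := measurable_wbad n bv.
rewrite -[X in (X <= _)%E]fineK ?fin_num_measure// lee_fin -Rint_indic//.
have := iid_markov n bv (bmeas_cst 1) (fun=> ler01).
under eq_Rintegral do rewrite big1// mulr1.
move=> /le_trans; apply.
have -> : \int[lam0]_x (1 * expR (v x)) = expR (- r).
  transitivity (\int[lam0]_x (expR (- (r + ln Z)) * expR (u x))).
    by apply: eq_Rintegral => x _; rewrite mul1r -expRD addrC.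
  rewrite RintZ; last exact: bmeas_expR.
  by rewrite opprD expRD -mulrA [expR (- ln Z)]expRN lnK ?posrE// mulVf ?mulr1// gt_eqF.
by rewrite -expRM_natl mulrN.
Qed.

(** As a function of [t] the exponential moment starts at 1 with slope [m < 0], so it is below 1 for
    small positive [t]; [expR_le_quad] makes this quantitative. *)
Lemma tilt_lt1 u h : bmeas u -> bmeas h -> (forall x, 0 <= h x) ->
  \int[lam0]_x h x = 1 -> \int[lam0]_x (h x * u x) < 0 ->
  exists2 t, 0 < t & \int[lam0]_x (h x * expR (t * u x)) < 1.
Proof.
move=> bu bh h0 h1; have [_ [M0 uM0]] := bu; set m := \int[lam0]_x _ => m0.
pose M := `|M0| + 1; have M_gt0 : 0 < M by rewrite ltr_wpDl.
have uM x : `|u x| <= M by rewrite (le_trans (uM0 x))// (le_trans (ler_norm _))// lerDl.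
(* The first bound gives [|t * u| <= 1/2], as [expR_le_quad] requires; the second makes the
   quadratic term [2 * t ^+ 2 * M ^+ 2] at most half of [- t * m]. *)
pose t := Num.min (2 * M)^-1 (- m / (4 * M ^+ 2)).
have t0 : 0 < t.
  rewrite lt_min invr_gt0 mulr_gt0//= divr_gt0 ?oppr_gt0// mulr_gt0// exprn_gt0//.
exists t => //.
have tu x : `|t * u x| <= 2^-1.
  rewrite normrM gtr0_norm// (@le_trans _ _ ((2 * M)^-1 * M))//.
    by apply: ler_pM => //; [exact: ltW|rewrite ge_min lexx].
  by rewrite invfM divfK// gt_eqF.
have tM : t * (4 * M ^+ 2) <= - m.
  by rewrite -ler_pdivlMr ?mulr_gt0 ?exprn_gt0// ge_min lexx orbT.
have bhu : bmeas (fun x => h x * u x) by exact: bmeasM.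
apply: (@le_lt_trans _ _ (\int[lam0]_x (t * (h x * u x) + (1 + 2 * (t ^+ 2 * M ^+ 2)) * h x))).
  apply: le_Rint.
  - by apply: bmeasM => //; apply: bmeas_expR; exact: bmeasZ.
  - by apply: bmeasD; exact: bmeasZ.
  move=> x; rewrite (le_trans (ler_wpM2l (h0 x) (expR_le_quad (tu x))))//.
  have u2 : u x ^+ 2 <= M ^+ 2 by rewrite -real_normK ?num_real// ler_sqr// ?nnegrE ?ltW.
  have := ler_wpM2l (h0 x) (ler_wpM2l (sqr_ge0 t) u2).
  rewrite exprMn; nra.
rewrite RintD; [|exact: bmeasZ|exact: bmeasZ].
rewrite !RintZ// h1 mulr1 -/m.
nra.
Qed.

(** The tilted law has total mass 1 and gives the bad event [j] mass at most [rho j ^+ n] with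
    [rho j < 1]; a finite union bound eventually leaves at least one half. *)
Lemma tilt_lower (I : finType) (u : I -> borel T -> R) h :
  (forall j, bmeas (u j)) -> bmeas h -> (forall x, 0 <= h x) ->
  \int[lam0]_x h x = 1 -> (forall j, \int[lam0]_x (h x * u j x) < 0) ->
  \forall n \near \oo,
    2^-1 <= \int[P]_om (\1_(\bigcap_(j in [set: I]) ~` wbad (u j) n) om *
                        \prod_(i < n) h (Ws i om)).
Proof.
move=> bu bh h0 h1 hu.
have /choice[t ht] j : exists t, 0 < t /\ \int[lam0]_x (h x * expR (t * u j x)) < 1.
  by have [t t0 ht] := tilt_lt1 (bu j) bh h0 h1 (hu j); exists t.
pose rho j := \int[lam0]_x (h x * expR (t j * u j x)).
have rho0 j : 0 <= rho j by apply: Rint_ge0 => x; rewrite mulr_ge0 ?expR_ge0.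
have rho1 j : rho j < 1 by have [] := ht j.
have cv : \sum_(j : I) rho j ^+ n @[n --> \oo] --> (0 : R).
  rewrite [X in _ --> X](_ : _ = \sum_(j : I) 0); last by rewrite big1.
  apply: cvg_big => [|j _]; first exact: add_continuous.
  by apply: cvg_expr; rewrite ger0_norm.
have half : 0 < 2^-1 :> R by rewrite invr_gt0.
have /cvgrPdist_le/(_ _ half) := cv; apply: filterS => n.
rewrite sub0r normrN => /ler_normlW hn.
have Pn0 om : 0 <= \prod_(i < n) h (Ws i om) by apply: prodr_ge0.
have mb j : measurable (wbad (u j) n) by exact: measurable_wbad.
have mS : measurable (\bigcap_(j in [set: I]) ~` wbad (u j) n).
  by apply: fin_bigcap_measurable => // j _; exact: measurableC.
have bPn := bmeas_wprod n bh.
have hb j : \int[P]_om (\1_(wbad (u j) n) om * \prod_(i < n) h (Ws i om)) <= rho j ^+ n.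
  have [tj0 _] := ht j.
  have <- : wbad (fun x => t j * u j x) n = wbad (u j) n.
    by apply/seteqP; split => om /=; rewrite /wbad/= /wsum -mulr_sumr pmulr_rge0.
  by apply: iid_markov => //; exact: bmeasZ.
have : 1 - \sum_(j : I) rho j ^+ n <=
   \int[P]_om (\1_(\bigcap_(j in [set: I]) ~` wbad (u j) n) om *
                        \prod_(i < n) h (Ws i om)).
  have E1 : \int[P]_om (\prod_(i < n) h (Ws i om)) = 1.
    by rewrite (iid_expect Ws_iid)// h1 expr1n.
  rewrite lerBlDr -[leLHS]E1.
  have bb j : bmeas (fun om => \1_(wbad (u j) n) om * \prod_(i < n) h (Ws i om)).
    by apply: bmeasM => //; exact: bmeas_indic.
  apply: (@le_trans _ _ (\int[P]_om (\1_(\bigcap_(j in [set: I]) ~` wbad (u j) n) om *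
                        \prod_(i < n) h (Ws i om)) +
    \sum_(j : I) \int[P]_om (\1_(wbad (u j) n) om * \prod_(i < n) h (Ws i om)))); last first.
    by rewrite lerD2l; apply: ler_sum => j _; exact: hb.
  have bS : bmeas (fun om => \1_(\bigcap_(j in [set: I]) ~` wbad (u j) n) om *
                        \prod_(i < n) h (Ws i om)).
    by apply: bmeasM => //; exact: bmeas_indic.
  rewrite -Rint_sum// -RintD//; last exact: bmeas_sum.
  apply: le_Rint => //; first by apply: bmeasD => //; exact: bmeas_sum.
  move=> om; rewrite -mulr_suml -mulrDl ler_peMl//.
  rewrite indicE; have [_|] := boolP (om \in _).
    by rewrite lerDl sumr_ge0// => j _; rewrite indicE.
  rewrite notin_setE => omS; rewrite add0r.
  have [j jb] : exists j, wbad (u j) n om.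
    by apply: contrapT => /forallNP H; apply: omS => j _; exact: H.
  by rewrite (bigD1 j)//= indicE mem_set// lerDl sumr_ge0// => k _; rewrite indicE.
lra.
Qed.

(* Under the law tilted by \prod_i h (W_i) every bad event is exponentially unlikely, including the
   event that the density of the tilted law exceeds expR (n * H). *)
Lemma iid_lower (I : finType) (u : I -> borel T -> R) h a H :
  (forall j, bmeas (u j)) -> bmeas h -> 0 < a -> (forall x, a <= h x) ->
  \int[lam0]_x h x = 1 -> (forall j, \int[lam0]_x (h x * u j x) < 0) ->
  \int[lam0]_x (h x * ln (h x)) < H ->
  \forall n \near \oo,
    ((2^-1 * expR (- (n%:R * H)))%:E <= P (\bigcap_(j in [set: I]) ~` wbad (u j) n))%E.
Proof.
move=> bu bh a0 ah h1 hu hH.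
have h0 x : 0 < h x by exact: lt_le_trans (ah x).
have blnh : bmeas (fun x => ln (h x)).
  have [mh [M hM]] := bh; split; first exact: measurableT_comp.
  exists (`|ln a| + `|ln M|) => x.
  have hxM : h x <= M by rewrite (le_trans (ler_norm _)).
  have M0 : 0 < M by exact: lt_le_trans hxM.
  rewrite ler_norml; apply/andP; split.
    rewrite lerNl (@le_trans _ _ (- ln a))//; first by rewrite lerN2 ler_ln ?posrE.
    by rewrite (le_trans (ler_norm _))// normrN lerDl.
  rewrite (@le_trans _ _ (ln M)) ?ler_ln ?posrE//.
  by rewrite (le_trans (ler_norm _))// lerDr.
(* The index [None] carries the log-density, whose mean under the tilt is below [H], so its excess
   is one more bad event. *)
pose u' (j : option I) := if j is Some j then u j else (fun x => ln (h x) - H).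
have bu' j : bmeas (u' j).
  by case: j => [j|] //=; apply: bmeasB => //; exact: bmeas_cst.
have hu' j : \int[lam0]_x (h x * u' j x) < 0.
  case: j => [j|] //=.
  have -> : \int[lam0]_x (h x * (ln (h x) - H)) =
      \int[lam0]_x (h x * ln (h x) - H * h x).
    by apply: eq_Rintegral => x _; rewrite mulrBr [_ * H]mulrC.
  rewrite RintB; [|exact: bmeasM|exact: bmeasZ].
  by rewrite RintZ// h1 mulr1 subr_lt0.
have := tilt_lower bu' bh (fun x => ltW (h0 x)) h1 hu'; apply: filterS => n hn.
have mS : measurable (\bigcap_(j in [set: I]) ~` wbad (u j) n).
  by apply: fin_bigcap_measurable => // j _; apply: measurableC; exact: measurable_wbad.
rewrite -[leRHS]fineK ?fin_num_measure// lee_fin expRN ler_pdivrMr ?expR_gt0//.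
rewrite (le_trans hn)// mulrC -Rint_indic// -RintZ; last exact: bmeas_indic.
apply: le_Rint.
- apply: bmeasM; last exact: bmeas_wprod.
  apply: bmeas_indic; apply: fin_bigcap_measurable => // j _.
  by apply: measurableC; exact: measurable_wbad.
- by apply/bmeasZ/bmeas_indic.
move=> om; rewrite indicE; have [/[!inE] omS|_] := boolP (om \in _); last first.
  by rewrite mul0r mulr_ge0 ?expR_ge0.
rewrite mul1r indicE mem_set ?mulr1; last by move=> j _; exact: (omS (Some j)).
have := omS None Logic.I; rewrite /wbad/= /wsum sumrB sumr_const card_ord => /negP.
rewrite -ltNge subr_lt0 mulr_natl => /ltW h2.
apply: le_trans (_ : expR (\sum_(i < n) ln (h (Ws i om))) <= _); last by rewrite ler_expR.
by rewrite expR_sum; apply: ler_prod => i _; rewrite lnK ?posrE// lexx andbT ltW.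
Qed.

End chernoff.

(** * Relative entropy *)

Section limn_bounds.
Context {R : realType}.
Implicit Types (u : (\bar R)^nat) (l : \bar R).

Lemma limn_einf_ge u l : (\forall n \near \oo, l <= u n)%E -> (l <= limn_einf u)%E.
Proof.
move=> [N _ Nu]; rewrite limn_einf_lim.
apply: (@le_trans _ _ (einfs u N)).
  by apply: le_ereal_inf_tmp => _ [n /= Nn <-]; exact: Nu.
by rewrite (cvg_lim _ (@cvg_einfs_sup _ u))//; apply: ereal_sup_ubound; exists N.
Qed.

Lemma limn_esup_le u l : (\forall n \near \oo, u n <= l)%E -> (limn_esup u <= l)%E.
Proof.
move=> [N _ Nu]; rewrite -leeN2 -limn_einfN; apply: limn_einf_ge.
by exists N => // n /Nu; rewrite /= leeN2.
Qed.

Lemma limn_einf_le u l : (\forall n \near \oo, u n <= l)%E -> (limn_einf u <= l)%E.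
Proof. by move=> /limn_esup_le; apply/le_trans/limn_einf_sup. Qed.

End limn_bounds.

Section xlnx.
Context {R : realType}.
Implicit Types x y : R.

Lemma xlnx_ge x : 0 <= x -> -1 <= x * ln x.
Proof.
rewrite le_eqVlt => /predU1P[<-|x0]; first by rewrite mul0r lerN10.
have := expR_ge1Dx (- ln x); rewrite expRN lnK ?posrE//.
rewrite -(ler_pM2l x0) divff ?gt_eqF// mulrDr mulr1 mulrN; lra.
Qed.

Lemma xlnx_le0 x : x <= 1 -> x * ln x <= 0.
Proof.
move=> x1; have [x0|x0] := leP x 0; first by rewrite (ln0 x0) mulr0.
by rewrite pmulr_rle0// ln_le0.
Qed.

Lemma le_xlnx x y : 1 <= x -> x <= y -> x * ln x <= y * ln y.
Proof.
move=> x1 xy; have x0 : 0 < x by exact: lt_le_trans x1.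
apply: ler_pM => //; [exact: ltW|exact: ln_ge0|].
by rewrite ler_ln ?posrE// (lt_le_trans x0).
Qed.

(** Cutting a density at both ends bounds the density and its logarithm at once. *)
Definition clamp (k : nat) y : R := Num.max k.+1%:R^-1 (Num.min y k.+1%:R).

Lemma clamp_ge k y : k.+1%:R^-1 <= clamp k y.
Proof. by rewrite le_max lexx. Qed.

Lemma clamp_gt0 k y : 0 < clamp k y.
Proof. by rewrite (lt_le_trans _ (clamp_ge k y))// invr_gt0. Qed.

Lemma clamp_le k y : clamp k y <= k.+1%:R.
Proof.
rewrite ge_max ge_min lexx orbT andbT.
by rewrite (@le_trans _ _ 1)// ?invf_le1// ler1n.
Qed.

Lemma clamp_leD k y : 0 <= y -> clamp k y <= y + k.+1%:R^-1.
Proof. by move=> y0; rewrite ge_max lerDr y0/= ge_min lerDl invr_ge0 ler0n. Qed.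

Lemma clamp_leD1 k y : 0 <= y -> clamp k y <= y + 1.
Proof.
by move=> y0; rewrite (le_trans (clamp_leD k y0))// lerD2l invf_le1// ler1n.
Qed.

Lemma clamp_id k y : k.+1%:R^-1 <= y -> y <= k.+1%:R -> clamp k y = y.
Proof. by move=> ky yk; rewrite /clamp (min_idPl yk); apply/max_idPr. Qed.

Lemma clamp_near y : 0 < y -> \forall k \near \oo, clamp k y = y.
Proof.
move=> y0; exists (maxn (Num.truncn y).+1 (Num.truncn y^-1).+1) => // k /=.
rewrite geq_max => /andP[k1 k2]; apply: clamp_id.
  rewrite -[leRHS]invrK lef_pV2 ?posrE ?invr_gt0//.
  by rewrite (le_trans (ltW (Num.Theory.truncnS_gt _)))// ler_nat leqW.
by rewrite (le_trans (ltW (Num.Theory.truncnS_gt _)))// ler_nat leqW.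
Qed.

Lemma clamp_ge_small k y : y <= 1 -> y <= clamp k y.
Proof. by move=> y1; rewrite le_max le_min lexx/= [y <= k.+1%:R](le_trans y1) ?orbT// ler1n. Qed.

Lemma clamp_ge1 k y : 1 <= y -> 1 <= clamp k y.
Proof. by move=> y1; rewrite le_max le_min y1 ler1n orbT. Qed.

(** A bound independent of [k], for dominated convergence. If the clamped value is at most 1, then
    [x * ln x] lies in [[-1, 0]]; otherwise clamping can only have lowered [y], and [x * ln x]
    increases above 1. *)
Lemma abs_xlnx_clamp k y : 0 <= y ->
  `|clamp k y * ln (clamp k y)| <= `|y * ln y| + 1.
Proof.
move=> y0; have [c1|c1] := leP (clamp k y) 1.
  rewrite ler0_norm ?xlnx_le0// lerNl (le_trans _ (xlnx_ge (ltW (clamp_gt0 k y))))//.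
  by rewrite lerN2 lerDr.
have cy : clamp k y <= y.
  move: c1; rewrite /clamp lt_max ltNge invf_le1// ler1n/= => h.
  rewrite ge_max ge_min lexx/= andbT (le_trans _ (ltW (lt_le_trans h _)))//.
    by rewrite invf_le1// ler1n.
  by rewrite ge_min lexx.
rewrite ger0_norm; last by rewrite mulr_ge0 ?ln_ge0 ?ltW ?clamp_gt0.
rewrite (le_trans (le_xlnx (ltW c1) cy))// (le_trans (ler_norm _))//.
by rewrite lerDl.
Qed.

Lemma bmeas_clamp k d (T : measurableType d) (f : T -> R) :
  measurable_fun setT f -> bmeas (fun z => clamp k (f z)).
Proof.
move=> mf; split.
  by apply: measurable_maxr => //; exact: measurable_minr.
by exists k.+1%:R => x; rewrite gtr0_norm ?clamp_gt0// clamp_le.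
Qed.

Lemma bmeas_ln_clamp k d (T : measurableType d) (f : T -> R) :
  measurable_fun setT f -> bmeas (fun z => ln (clamp k (f z))).
Proof.
move=> mf; have [mc _] := bmeas_clamp k mf; split; first exact: measurableT_comp.
exists (ln k.+1%:R) => x; rewrite ler_norml; apply/andP; split.
  by rewrite -lnV ?posrE// ler_ln ?posrE ?clamp_gt0 ?invr_gt0// clamp_ge.
by rewrite ler_ln ?posrE ?clamp_gt0// clamp_le.
Qed.

End xlnx.

Section entropy.
Context {R : realType} d {T : measurableType d}.

Lemma Rint_dominated (m : probability T R) (f_ : nat -> T -> R) (f g : T -> R) :
  (forall n, measurable_fun setT (f_ n)) ->
  (forall x, f_ n x @[n --> \oo] --> f x) ->
  m.-integrable setT (EFin \o g) -> (forall n x, `|f_ n x| <= g x) ->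
  \int[m]_x f_ n x @[n --> \oo] --> \int[m]_x f x.
Proof.
move=> mf cf ig fg.
have mf' : measurable_fun setT f.
  by apply: (measurable_fun_cvg mf) => x _; exact: cf.
have fg' x : `|f x| <= g x.
  have cn : `|f_ n x| @[n --> \oo] --> `|f x| by exact: cvg_norm.
  rewrite -(cvg_lim _ cn)//; apply: limr_le; first exact: cvgP cn.
  by apply: nearW => n; exact: fg.
have if_ : m.-integrable setT (EFin \o f).
  apply: (le_integrable measurableT _ _ ig) => [|x _]; first exact/measurable_EFinP.
  by rewrite /= lee_fin (le_trans (fg' x))// ler_norm.
apply: fine_cvg; rewrite fineK; last exact: integrable_fin_num.
apply: (dominated_cvg measurableT (g := EFin \o g)) => //.
- by move=> n; exact/measurable_EFinP.
- by move=> x _; apply/fine_cvgP; split; [exact: nearW|exact: cf].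
- by move=> n x _; rewrite lee_fin.
Qed.

Variables (lam lam0 : probability T R).

Lemma density_integrable f : density lam lam0 f -> lam0.-integrable setT (EFin \o f).
Proof.
move=> [mf f0 df]; apply/integrableP; split; first exact/measurable_EFinP.
under eq_integral do rewrite gee0_abs ?lee_fin//.
by rewrite -df// probability_setT ltry.
Qed.

(** The negative part of [x * ln x] is at most 1, hence integrable, so an integral below [+oo]
    forces the positive part to be integrable too. *)
Lemma xlnx_integrable (f : T -> R) : measurable_fun setT f -> (forall x, 0 <= f x) ->
  (\int[lam0]_x (f x * ln (f x))%:E < +oo)%E ->
  lam0.-integrable setT (EFin \o (fun x => f x * ln (f x))).
Proof.
move=> mf f0 If.
have mg : measurable_fun setT (fun x => f x * ln (f x)).
  by apply: measurable_funM => //; exact: measurableT_comp.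
have mG : measurable_fun setT (EFin \o (fun x => f x * ln (f x))) by exact/measurable_EFinP.
apply/integrableP; split => //.
set g := EFin \o _ in If mG *.
have -> : (fun x => `|g x|)%E = (g^\+ \+ g^\-)%E by rewrite -fune_abse.
rewrite ge0_integralD//; [|exact: measurable_funepos|exact: measurable_funeneg].
have n1 : (\int[lam0]_x g^\- x <= 1)%E.
  apply: (@le_trans _ _ (\int[lam0]_(x in setT) 1%:E)%E).
    apply: ge0_le_integral => //; first exact: measurable_funeneg.
    move=> x _; rewrite funenegE ge_max lee01 andbT -EFinN lee_fin lerNl.
    exact: xlnx_ge.
  by rewrite integral_cst// mul1e -[leLHS]/(lam0 setT) probability_setT.
have nfin : (\int[lam0]_x g^\- x)%E \is a fin_num.
  rewrite ge0_fin_numE; last by apply: integral_ge0.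
  by rewrite (le_lt_trans n1)// ltry.
rewrite lte_add_pinfty//; last by rewrite -ge0_fin_numE// integral_ge0.
rewrite ltey; apply/negP => /eqP gy.
by move: If; rewrite [X in (X < _)%E]integralE -/g gy; case: (\int[_]_x g^\- x)%E nfin.
Qed.

(** Supplies the density for [iid_lower]. The density of [lam] is clamped and divided by its
    integral [A k], which tends to 1; the masses of the [E i] converge and the entropy stays below
    [r] for large [k]. *)
Lemma relent_approx r (I : finType) (E : I -> set T) e : (relent lam lam0 < r%:E)%E ->
  (forall i, measurable (E i)) -> 0 < e -> exists (h : T -> R) (a : R),
  [/\ bmeas h, 0 < a & forall x, a <= h x] /\
  [/\ \int[lam0]_x h x = 1, \int[lam0]_x (h x * ln (h x)) < r &
    forall i, `|\int[lam0]_x (h x * \1_(E i) x) - fine (lam (E i))| < e].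
Proof.
move=> hr mE e0.
have [f df Hf] : exists2 f, density lam lam0 f & (\int[lam0]_x (f x * ln (f x))%:E < r%:E)%E.
  by have [_ [f df <-] Hf] := ereal_inf_lt hr; exists f.
have [mf f0 lamE] := df.
have if_ := density_integrable df.
have ig : lam0.-integrable setT (EFin \o (fun x => f x * ln (f x))).
  by apply: xlnx_integrable => //; rewrite (lt_trans Hf)// ltry.
pose H := \int[lam0]_x (f x * ln (f x)).
have Hr : H < r by rewrite -lte_fin fineK//; exact: integrable_fin_num.
have i1 : lam0.-integrable setT (EFin \o (fun=> 1 : R)) by exact/bmeas_integrable/bmeas_cst.
have iD (g : T -> R) : lam0.-integrable setT (EFin \o g) ->
    lam0.-integrable setT (EFin \o (fun x => g x + 1)).
  by move=> ig'; exact: (integrableD measurableT ig' i1).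
have Rlam A : measurable A -> \int[lam0]_x (f x * \1_A x) = fine (lam A).
  move=> mA; rewrite lamE// /Rintegral [in RHS]integral_mkcond; congr fine.
  apply: eq_integral => x _; rewrite /patch indicE; case: (x \in A); first by rewrite mulr1.
  by rewrite mulr0.
have cl x : clamp k (f x) @[k --> \oo] --> f x.
  have := f0 x; rewrite le_eqVlt => /predU1P[<-|fx]; last first.
    by apply: cvg_near_cst; exact: clamp_near.
  apply: (@squeeze_cvgr _ _ _ _ (fun=> 0) (fun k => k.+1%:R^-1)).
  - by apply: nearW => k; rewrite ltW ?clamp_gt0//= -[leRHS]add0r clamp_leD.
  - exact: cvg_cst.
  - exact: cvg_harmonic.
have bq k : bmeas (fun x => clamp k (f x)) by exact: bmeas_clamp.
have blq k : bmeas (fun x => ln (clamp k (f x))) by exact: bmeas_ln_clamp.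
have cC A : measurable A ->
    \int[lam0]_x (clamp k (f x) * \1_A x) @[k --> \oo] --> fine (lam A).
  move=> mA; rewrite -Rlam//; apply: (Rint_dominated (g := fun x => f x + 1)) => //.
  - by move=> n; have [] := bmeasM (bq n) (bmeas_indic mA).
  - by move=> x; apply: cvgMl; exact: cl.
  - exact: iD.
  - move=> n x; rewrite ger0_norm; last by rewrite mulr_ge0 ?(ltW (clamp_gt0 _ _))// indicE.
    rewrite (le_trans _ (clamp_leD1 n (f0 x)))//.
    by apply: ler_piMr; rewrite ?(ltW (clamp_gt0 _ _))// indicE; case: (_ \in _).
pose A k := \int[lam0]_x clamp k (f x).
have cA : A k @[k --> \oo] --> (1 : R).
  have := cC _ measurableT; rewrite probability_setT /=.
  by under eq_fun do under eq_Rintegral do rewrite indicT mulr1.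
have mpos : measurable [set x | 0 < f x].
  rewrite -[X in measurable X]setTI.
  have -> : [set x | 0 < f x] = f @^-1` `]0, +oo[%classic.
    by apply/seteqP; split => x /=; rewrite in_itv/= andbT.
  exact: mf.
(* Dropping {f = 0}, where the integrand is nonpositive, makes the convergence pointwise eventually
   constant. *)
pose B k := \int[lam0]_x (clamp k (f x) * ln (clamp k (f x)) * \1_[set x | 0 < f x] x).
have cB : B k @[k --> \oo] --> H.
  apply: (Rint_dominated (g := fun x => `|f x * ln (f x)| + 1)).
  - by move=> n; have [] := bmeasM (bmeasM (bq n) (blq n)) (bmeas_indic mpos).
  - move=> x; apply: cvg_near_cst; have := f0 x; rewrite le_eqVlt => /predU1P[fx0|fx].
      apply: nearW => k; rewrite -fx0 mul0r indicE memNset ?mulr0//=.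
      by rewrite -fx0 ltxx.
    apply: filterS (clamp_near fx) => k ->.
    by rewrite indicE mem_set ?mulr1.
  - by apply: iD; have := integrable_abse ig.
  - move=> n x; rewrite normrM (le_trans _ (abs_xlnx_clamp n (f0 x)))//.
    by apply: ler_piMr => //; rewrite indicE; case: (_ \in _); rewrite ?normr1 ?normr0.
(* Normalization contributes the term [- ln (A k)]. Restricting to [f > 0] can only raise the
   integral, since the clamped value on [f = 0] is at most 1. *)
have hk k : 0 < A k ->
    \int[lam0]_x ((A k)^-1 * clamp k (f x) * ln ((A k)^-1 * clamp k (f x))) <=
    (A k)^-1 * B k - ln (A k).
  move=> Ak0.
  have -> : (fun x => (A k)^-1 * clamp k (f x) * ln ((A k)^-1 * clamp k (f x))) =
      (fun x => (A k)^-1 * (clamp k (f x) * ln (clamp k (f x))) -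
        (A k)^-1 * ln (A k) * clamp k (f x)).
    by apply/funext => x; rewrite lnM ?posrE ?invr_gt0 ?clamp_gt0// lnV ?posrE//; ring.
  have bm := bmeasM (bq k) (blq k).
  rewrite RintB; [|exact: bmeasZ|exact: bmeasZ].
  rewrite !RintZ// -/(A k) mulrAC mulVf ?gt_eqF// mul1r lerD2r ler_pM2l ?invr_gt0//.
  apply: le_Rint => //; first exact/bmeasM/bmeas_indic.
  move=> x; rewrite indicE; have [_|] := boolP (x \in _); first by rewrite mulr1.
  rewrite notin_setE /= => fx; rewrite mulr0.
  apply: xlnx_le0; have -> : f x = 0 by apply/eqP; rewrite eq_le f0 leNgt andbT; exact/negP.
  rewrite /clamp (min_idPl _)//; rewrite ge_max ler01 andbT invf_le1// ler1n//.
have cAV : (A k)^-1 @[k --> \oo] --> (1 : R) by rewrite -[X in _ --> X]invr1; exact: cvgV.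
have c1 : (A k)^-1 * B k - ln (A k) @[k --> \oo] --> H.
  rewrite -[X in _ --> X]subr0 -[X in _ - X](ln1 R) -[X in X - _]mul1r.
  apply: cvgB; first exact: cvgM.
  by apply: (continuous_cvg _ _ cA); exact: continuous_ln.
have c2 i : (A k)^-1 * \int[lam0]_x (clamp k (f x) * \1_(E i) x) @[k --> \oo] --> fine (lam (E i)).
  by rewrite -[X in _ --> X]mul1r; apply: cvgM => //; exact: cC.
have nA : \forall k \near \oo, 0 < A k by exact: cvgr_gt cA _ ltr01.
have n1 : \forall k \near \oo, (A k)^-1 * B k - ln (A k) < r by exact: cvgr_lt c1 _ Hr.
have n2 : \forall k \near \oo, forall i,
    `|(A k)^-1 * \int[lam0]_x (clamp k (f x) * \1_(E i) x) - fine (lam (E i))| < e.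
  apply: filter_forall => i; have /cvgrPdist_lt/(_ _ e0) := c2 i.
  by apply: filterS => k; rewrite distrC.
have [k [[Ak0 hB] hE]] := filter_ex (filterI (filterI nA n1) n2).
exists (fun x => (A k)^-1 * clamp k (f x)), ((A k)^-1 * k.+1%:R^-1).
split; split.
- exact: bmeasZ.
- by rewrite mulr_gt0 ?invr_gt0.
- by move=> x; rewrite ler_pM2l ?invr_gt0// clamp_ge.
- by rewrite RintZ// mulVf// gt_eqF.
- exact: le_lt_trans (hk k Ak0) hB.
- move=> i; under eq_Rintegral do rewrite -mulrA.
  by rewrite RintZ//; exact/bmeasM/bmeas_indic.
Qed.

End entropy.

(** * Entropy bound from the variational inequality *)

Section variational.
Context {R : realType} d {T : measurableType d} (lam lam0 : probability T R) (r : R).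
Hypothesis var : forall g : T -> R, bmeas g ->
  \int[lam]_x g x <= r + ln (\int[lam0]_x expR (g x)).

(* Tested on g = t * \1_E with lam0 E = 0, the inequality gives t * lam E <= r for every t. *)
Lemma variational_dominates : lam `<< lam0.
Proof.
apply/null_content_dominatesP => E mE E0.
have bE := bmeas_indic (R := R) mE.
have H t : t * fine (lam E) <= r.
  have := var (bmeasZ t bE); rewrite RintZ// Rint_indic//.
  have -> : \int[lam0]_x expR (t * \1_E x) = 1.
    have -> : (fun x => expR (t * \1_E x)) = fun x => 1 + (expR t - 1) * \1_E x.
      apply/funext => x; rewrite indicE; case: (x \in E); first by rewrite !mulr1 addrC subrK.
      by rewrite !mulr0 expR0 addr0.
    rewrite RintD; [|exact: bmeas_cst|exact: bmeasZ].
    by rewrite RintZ// Rint_indic// E0/= mulr0 addr0 Rint_cst.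
  by rewrite ln1 addr0.
have f0 : 0 <= fine (lam E) by exact: fine_ge0.
apply/eqP; rewrite -[X in X == _]fineK ?fin_num_measure// eqe.
apply/eqP/le_anti; rewrite f0 andbT leNgt; apply/negP => p.
have := H ((`|r| + 1) / fine (lam E)); rewrite divfK ?gt_eqF//.
have := ler_norm r; lra.
Qed.

(** The optimal test function would be the logarithm of the Radon-Nikodym density [f]. It may be
    unbounded, so the inequality is applied to the logarithm of the clamped density, and Fatou's
    lemma passes to the limit. *)
Lemma relent_le : (relent lam lam0 <= r%:E)%E.
Proof.
have ll := variational_dominates.
pose F := Radon_Nikodym_SigmaFinite.f lam lam0.
have Ffin := Radon_Nikodym_SigmaFinite.f_fin_num ll.
have F0 := Radon_Nikodym_SigmaFinite.f_ge0 ll.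
have FI := Radon_Nikodym_SigmaFinite.f_integrable ll.
have FE := Radon_Nikodym_SigmaFinite.f_integral ll.
pose f x := fine (F x).
have fF x : (f x)%:E = F x by rewrite fineK.
have f0 x : 0 <= f x by exact: fine_ge0.
have mf : measurable_fun setT f.
  apply/measurable_EFinP; rewrite (_ : EFin \o f = F); last by apply/funext => x; exact: fF.
  by have /integrableP[] := FI.
have df : density lam lam0 f.
  by split => // E mE; rewrite FE//; apply: eq_integral => x _; rewrite fF.
have [_ _ lamE] := df; have if_ := density_integrable df.
have bdd (g : T -> R) : bmeas g -> lam0.-integrable setT (EFin \o (fun x => g x * f x)).
  move=> [mg [M gM]]; apply: (integrableMr measurableT mg _ if_).
  by exists M; split; [rewrite num_real | move=> N MN x _ /=; rewrite (le_trans (gM x))// ltW].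
have Ig g : bmeas g -> \int[lam0]_x (g x * f x) = \int[lam]_x g x.
  apply: (posfun_eq (L := fun g => \int[lam0]_x (g x * f x))); last 2 first.
  - exact: posfun_Rint.
  - move=> E mE; rewrite Rint_indic// lamE//.
    rewrite [in RHS]integral_mkcond; congr fine; apply: eq_integral => x _.
    by rewrite /patch indicE; case: (_ \in _); rewrite ?mul1r ?mul0r.
  split.
  - move=> g1 g2 b1 b2; rewrite -RintegralD//; [|exact: bdd|exact: bdd].
    by apply: eq_Rintegral => x _; rewrite mulrDl.
  - move=> c g1 b1; rewrite -RintegralZl//; last exact: bdd.
    by apply: eq_Rintegral => x _; rewrite mulrA.
  - by move=> g1 _ g0; apply: Rint_ge0 => x; rewrite mulr_ge0.
pose q k x := clamp k (f x).
have bq k : bmeas (q k) by exact: bmeas_clamp.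
have blq k : bmeas (fun x => ln (q k x)) by exact: bmeas_ln_clamp.
have i1 : lam0.-integrable setT (EFin \o (fun=> 1 : R)) by exact/bmeas_integrable/bmeas_cst.
(* Clamping adds at most [1 / (k + 1)] to [f], so the exponential moment is at most
   [1 + 1 / (k + 1)], and [ln (1 + x) <= x]. *)
have hk k : \int[lam0]_x (ln (q k x) * f x) <= r + k.+1%:R^-1.
  rewrite Ig//; apply: (le_trans (var (blq k))); rewrite lerD2l.
  under eq_Rintegral do rewrite lnK ?posrE ?clamp_gt0//.
  have qf : \int[lam0]_x q k x <= 1 + k.+1%:R^-1.
    have bc := bmeas_cst (T := T) (k.+1%:R^-1 : R).
    have -> : 1 + k.+1%:R^-1 = \int[lam0]_x (f x + k.+1%:R^-1).
      rewrite RintegralD//; last exact: bmeas_integrable.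
      rewrite Rint_cst; congr (_ + _); rewrite /Rintegral.
      by rewrite -lamE// probability_setT.
    apply: le_Rintegral => //; first exact: bmeas_integrable.
      exact: (integrableD measurableT if_ (bmeas_integrable lam0 bc)).
    by move=> x _; exact: clamp_leD.
  have q0 : 0 < \int[lam0]_x q k x.
    apply: (@lt_le_trans _ _ (\int[lam0]_(x in setT) k.+1%:R^-1)).
      by rewrite Rint_cst invr_gt0.
    by apply: le_Rint => //; [exact: bmeas_cst|move=> x; exact: clamp_ge].
  apply: le_trans (le_ln1Dx _); last by rewrite (@lt_le_trans _ _ 0)// invr_ge0.
  by rewrite ler_ln ?posrE// (lt_le_trans q0).
(* Adding 1 makes the integrands nonnegative, because [x * ln x] is at least -1, so Fatou's lemma
   applies. *)
pose G k x : \bar R := (ln (q k x) * f x + 1)%:E.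
have mG k : measurable_fun setT (G k).
  apply/measurable_EFinP; apply: measurable_funD => //; apply: measurable_funM => //.
  by have [] := blq k.
have G0 k x : (0 <= G k x)%E.
  rewrite lee_fin; have [f1|f1] := leP (f x) 1; last first.
    by rewrite addr_ge0// mulr_ge0// ln_ge0// clamp_ge1// ltW.
  apply: (@le_trans _ _ (f x * ln (f x) + 1)); first by rewrite -lerBlDr sub0r xlnx_ge.
  rewrite lerD2r mulrC; have := f0 x; rewrite le_eqVlt => /predU1P[<-|fx].
    by rewrite !mulr0.
  by rewrite ler_wpM2r// ler_ln ?posrE ?clamp_gt0// clamp_ge_small.
have cG x : limn_einf (G ^~ x) = (f x * ln (f x) + 1)%:E.
  have [-> //] : (limn_einf (G ^~ x) = (f x * ln (f x) + 1)%:E) *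
    (limn_esup (G ^~ x) = (f x * ln (f x) + 1)%:E).
  apply: cvg_limn_einf_sup; apply: cvg_near_cst.
  have := f0 x; rewrite le_eqVlt => /predU1P[fx|fx].
    by apply: nearW => k; rewrite /G -fx mulr0 mul0r.
  by apply: filterS (clamp_near fx) => k h; rewrite /G /q h mulrC.
have IG k : (\int[lam0]_x G k x <= (r + k.+1%:R^-1 + 1)%:E)%E.
  have -> : (\int[lam0]_x G k x = (\int[lam0]_x (ln (q k x) * f x) + 1)%:E)%E.
    rewrite -[X in (_ + X)%:E](Rint_cst lam0) -RintegralD//; last exact: bdd.
    by rewrite fineK// integrable_fin_num//; apply: (integrableD measurableT (bdd _ (blq k)) i1).
  by rewrite lee_fin lerD2r.
have h1 : (\int[lam0]_x (f x * ln (f x) + 1)%:E <= (r + 1)%:E)%E.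
  under eq_integral do rewrite -cG.
  apply: (le_trans (fatou lam0 measurableT mG (fun k x _ => G0 k x))).
  apply/lee_addgt0Pr => e e0; apply: limn_einf_le.
  exists (Num.truncn e^-1) => // k /= ke; apply: (le_trans (IG k)).
  rewrite -EFinD lee_fin addrAC lerD2l -[leRHS]invrK lef_pV2 ?posrE ?invr_gt0//.
  by rewrite (le_trans (ltW (Num.Theory.truncnS_gt _)))// ler_nat.
have mg : measurable_fun setT (fun x => f x * ln (f x)).
  by apply: measurable_funM => //; exact: measurableT_comp.
have i2 : lam0.-integrable setT (EFin \o (fun x => f x * ln (f x) + 1)).
  apply/integrableP; split; first by apply/measurable_EFinP; exact: measurable_funD.
  under eq_integral do rewrite gee0_abs ?lee_fin -?lerBlDr ?sub0r ?xlnx_ge//.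
  by rewrite (le_lt_trans h1)// ltry.
apply: (@le_trans _ _ (\int[lam0]_x (f x * ln (f x))%:E)%E).
  by apply: ereal_inf_lbound; exists f.
have -> : (\int[lam0]_x (f x * ln (f x))%:E =
   \int[lam0]_x (f x * ln (f x) + 1)%:E - \int[lam0]_(x in setT) 1%:E)%E.
  rewrite -integralB//; apply: eq_integral => x _.
  by rewrite -EFinB addrK.
rewrite integral_cst// mul1e -[X in (_ - X)%E]/(lam0 setT) probability_setT.
by rewrite leeBlDr// -EFinD.
Qed.

End variational.

(** * Limits of empirical measures *)

Section empirical.
Context {R : realType} d {T : measurableType d}.

Lemma pnat_ord (S : pointedType) n (p : 'I_n -> S) (i : 'I_n) : Defs.pnat p i = p i.
Proof. by rewrite /Defs.pnat valK. Qed.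

Lemma empiricalE n (p : 'I_n -> T) (E : set T) : (0 < n)%N ->
  (empirical p : probability T R) E = (n%:R^-1 * \sum_(i < n) \1_E (p i))%:E.
Proof.
move=> n0.
pose mm : set T -> \bar R := msum (fun k => \d_(Defs.pnat p k)) n.
(* Unfolding [mnormalize]: for positive [n] the total mass [n] is neither 0 nor infinite, so the
   default Dirac mass is not taken. *)
rewrite -[LHS]/((if (mm setT == 0%E) || (mm setT == +oo%E) then fun U => \d_point U
  else fun U => (mm U * (fine (mm setT))^-1%:E)%E) E).
have msumE A : mm A = (\sum_(i < n) \1_A (p i))%:E.
  rewrite /mm /msum -sumEFin; apply: eq_bigr => i _.
  by rewrite /= diracE pnat_ord indicE.
rewrite !msumE.
have -> : \sum_(i < n) \1_[set: T] (p i) = n%:R :> R.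
  by under eq_bigr do rewrite indicT; rewrite sumr_const card_ord.
by rewrite eqe pnatr_eq0 gtn_eqF//= msumE -EFinM mulrC.
Qed.

Lemma Rint_empirical n (p : 'I_n -> T) (f : T -> R) : (0 < n)%N -> bmeas f ->
  \int[empirical p]_x f x = n%:R^-1 * \sum_(i < n) f (p i).
Proof.
move=> n0; apply: (posfun_eq (L' := fun f => n%:R^-1 * \sum_(i < n) f (p i))).
- exact: posfun_Rint.
- split.
  + by move=> g h _ _; rewrite big_split mulrDr.
  + by move=> c g _; rewrite -mulr_sumr mulrCA.
  + by move=> g _ g0; rewrite mulr_ge0// sumr_ge0.
- by move=> E mE; rewrite Rint_indic// empiricalE.
Qed.

End empirical.

Lemma separable_second_countable {R : realType} {T : pseudoMetricType R} :
  (exists D : set T, countable D /\ dense D) -> @second_countable T.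
Proof.
move=> [D [cD dD]].
(* Interiors are taken because balls of a pseudometric structure need not be open here. *)
pose f n (z : T) : set T := (ball z (n.+1%:R^-1 : R))°.
exists (\bigcup_n (f n) @` D); [|split].
- by apply: bigcup_countable => // n _; apply: (sub_countable (card_image_le _ _)).
- by move=> ? [? _ [? _ <-]]; exact: open_interior.
- move=> x V /nbhs_ballP [e /= e0 ballsubV].
  pose n := Num.truncn (2 / e).
  have ne : n.+1%:R^-1 <= e / 2.
    rewrite -[leRHS]invrK lef_pV2 ?posrE ?invr_gt0 ?divr_gt0// invf_div.
    exact/ltW/Num.Theory.truncnS_gt.
  have n0 : 0 < n.+1%:R^-1 :> R by rewrite invr_gt0.
  have n20 : 0 < n.+1%:R^-1 / 2 :> R by rewrite divr_gt0.
  have [w [/interior_subset xw Dw]] : (ball x (n.+1%:R^-1 / 2 : R))° `&` D !=set0.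
    apply: dD; last exact: open_interior.
    by exists x; rewrite /interior; exact: (nbhsx_ballx x _ n20).
  have wx : f n w x.
    apply: filterS (nbhsx_ballx x _ n20) => z xz.
    by rewrite [n.+1%:R^-1]splitr; apply: ball_triangle xz; exact/ball_sym.
  exists (f n w); first by split => //; exists n => //; exists w.
  move=> z /interior_subset wz; apply: ballsubV.
  rewrite [e]splitr; apply: (@ball_triangle _ _ w).
    apply: le_ball xw; apply: le_trans ne; by rewrite ler_pdivrMr// ler_peMr ?(ltW n0)// ler1n.
  exact: le_ball wz.
Qed.

Lemma countable_enum (T : Type) (B : set (set T)) : countable B ->
  exists e : nat -> set T, (forall k, B (e k) \/ e k = set0) /\
    forall U, B U -> exists k, e k = U.
Proof.
move=> /countable_injP[f finj].
exists (fun k => if pselect (exists U, B U /\ f U = k) is left H then projT1 (cid H) else set0).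
split => [k|U BU].
  by case: pselect => [H|_]; [left; case: cid => /= x []|right].
exists (f U); case: pselect => [H|[]]; last by exists U.
case: cid => /= V [BV fVU]; apply: finj; rewrite ?inE//.
Qed.

(** The tube lemma: if the whole compact fibre over [w] avoids [A], so do the fibres over all points
    near [w]. *)
Lemma closed_fst {R : realType} {W X : pseudoMetricType R} (A : set (W * X)) :
  compact [set: X] -> closed A -> closed [set w | exists x, A (w, x)].
Proof.
move=> cX cA; rewrite -[X in closed X]setCK; apply: open_closedC.
rewrite openE => w /= nw.
have := (compact_near_coveringP [set: X]).1 cX W (nbhs w) (fun w' x => ~ A (w', x)) _.
move=> H; have : \forall w' \near w, [set: X] `<=` (fun x => ~ A (w', x)).
  apply: H => x _.
  have : nbhs (w, x) (~` A).
    by apply: open_nbhs_nbhs; split; [exact: closed_openC|move=> Awx; apply: nw; exists x].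
  by move=> [[U V] /= [Uw Vx] UV]; exists (V, U) => //= -[x' w'] [/= Vx' Uw']; exact: (UV (w', x')).
by apply: filterS => w' H' /= [x]; exact: H'.
Qed.

Lemma le_cvg_to {R : realType} {I : Type} (F : set_system I) (f g : I -> R) (a b : R) :
  ProperFilter F -> f i @[i --> F] --> a -> g i @[i --> F] --> b ->
  (forall i, f i <= g i) -> a <= b.
Proof.
move=> PF fa gb fg; have cB : g i - f i @[i --> F] --> b - a by exact: cvgB.
rewrite -subr_ge0 -(cvg_lim _ cB)//; apply: limr_ge; first exact: cvgP cB.
by apply: nearW => i; rewrite subr_ge0.
Qed.

Section ultralimit.
Context {R : realType} {I : Type} (U : set_system I).

(** The image of an ultrafilter is an ultrafilter, and this one contains the compact interval
    [[-M, M]]. *)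
Lemma ultra_bounded_cvg (u : I -> R) M : UltraFilter U -> (forall i, `|u i| <= M) ->
  cvg (u i @[i --> U]).
Proof.
move=> UU uM.
have UV : UltraFilter (u i @[i --> U]).
  split; first exact: fmap_proper_filter.
  move=> G PG UG; apply/seteqP; split => [A GA|]; last exact: UG.
  have [//|FnA] := in_ultra_setVsetC (u @^-1` A) UU.
  have GnA : G (~` A) by exact: UG.
  by have /filter_ex[? []] : G (A `&` ~` A) by exact: filterI.
have : compact (`[- M, M]%classic : set R) by exact: segment_compact.
rewrite compact_ultra => /(_ _ UV) []; last by move=> l [_ ul]; exact: cvgP ul.
by apply: nearW => i; rewrite /= in_itv/= -ler_norml.
Qed.

End ultralimit.

(** * Topology and product sigma-algebra on the product space *)

Section product_borel.
Context {R : realType} {W X : pseudoPMetricType R}.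

HB.instance Definition _ := Pointed.on (W * X)%type.

Hypothesis W2 : @second_countable W.
Hypothesis X2 : @second_countable X.
Implicit Types (O : set (W * X)).

(** Rectangles over two countable bases. This is what makes open sets of the product belong to the
    product sigma-algebra. *)
Lemma prod_base : exists Q : nat -> set (W * X),
  [/\ forall k, open (Q k),
      forall k, measurable (Q k : set (borel W * borel X)) &
      forall O z, open O -> O z -> exists k, Q k z /\ Q k `<=` O].
Proof.
have [BW cW [oW bW]] := W2; have [BX cX [oX bX]] := X2.
have [eW [eWB eWs]] := countable_enum cW; have [eX [eXB eXs]] := countable_enum cX.
have oeW k : open (eW k) by case: (eWB k) => [/oW//|->]; exact: open0.
have oeX k : open (eX k) by case: (eXB k) => [/oX//|->]; exact: open0.
pose Q k := let ij := odflt (0%N, 0%N) (unpickle k) in eW ij.1 `*` eX ij.2.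
exists Q; split => [k|k|O [w x] oO Owx].
- rewrite /Q; set ij := odflt _ _.
  rewrite (_ : _ `*` _ = fst @^-1` eW ij.1 `&` snd @^-1` eX ij.2)//.
  by apply: openI; apply: open_comp => // z _; [exact: cvg_fst|exact: cvg_snd].
- by apply: measurableX; exact: sub_sigma_algebra.
have : nbhs (w, x) O by exact: open_nbhs_nbhs.
move=> [[A B] /= [Aw Bx] AB].
have [U [BU Uw] UA] := bW w A Aw; have [V [BV Vx] VB] := bX x B Bx.
have [i iU] := eWs U BU; have [j jV] := eXs V BV.
exists (pickle (i, j)); rewrite /Q pickleK/= iU jV; split => //.
by move=> [w' x'] [/= /UA Aw' /VB Bx']; exact: AB.
Qed.

Lemma open_measurable_prod O : open O -> measurable (O : set (borel W * borel X)).
Proof.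
have [Q [oQ mQ bQ]] := prod_base => oO.
rewrite [X in measurable X](_ : _ = \bigcup_(k in [set k | Q k `<=` O]) Q k).
  by apply: bigcup_measurable => k _; exact: mQ.
apply/seteqP; split => [z Oz|z [k /= QO]]; last exact: QO.
by have [k [Qz QO]] := bQ O z oO Oz; exists k.
Qed.

Lemma bcont_bmeas_prod (f : W * X -> R) : bcont f -> bmeas (f : borel W * borel X -> R).
Proof.
move=> [cf bf]; split => //.
apply: (measurability _ (@RGenOpens.measurableE R)) => _ [_ [a [b ->] <-]].
rewrite setTI; apply: open_measurable_prod.
by apply: open_comp => [z _|]; [exact: cf|exact: interval_open].
Qed.

(** The identity, from the Borel sigma-algebra of the product to the product of the Borel
    sigma-algebras; it transports the Riesz measure. *)
Definition borel_pair (z : borel (W * X)%type) : borel W * borel X := z.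

Lemma measurable_borel_pair : measurable_fun setT borel_pair.
Proof.
apply/measurable_fun_pairP; split.
- apply: (measurability _ (erefl (@measurable _ (borel W)))) => _ [U oU <-]; rewrite setTI.
  by apply: sub_sigma_algebra; apply: open_comp => // z _; exact: cvg_fst.
- apply: (measurability _ (erefl (@measurable _ (borel X)))) => _ [U oU <-]; rewrite setTI.
  by apply: sub_sigma_algebra; apply: open_comp => // z _; exact: cvg_snd.
Qed.

HB.instance Definition _ := isMeasurableFun.Build _ _ _ _ borel_pair measurable_borel_pair.

Lemma riesz_prod (L : (W * X -> R) -> R) : daniell L ->
  exists m : probability (borel W * borel X)%type R,
  forall f, bcont f -> \int[m]_z f z = L f.
Proof.
move=> dL; have [m0 hm0] := @riesz R (W * X)%type L dL.
exists (distribution m0 borel_pair) => f bf; rewrite -hm0// /Rintegral; congr fine.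
have [mf _] := bcont_bmeas_prod bf.
rewrite (integral_pushforward (D := setT) measurable_borel_pair)//.
- exact/measurable_EFinP.
- exact: (bmeas_integrable m0 (bcont_bmeas bf)).
Qed.

(** Lindelof argument: every point of [S] lies in a null member of the countable base, and the union
    of these members is null. *)
Lemma null_cover (m : probability (borel W * borel X)%type R) (S : set (W * X)) :
  (forall z, S z -> exists O, [/\ open O, O z & m O = 0%E]) ->
  m.-negligible (S : set (borel W * borel X)).
Proof.
move=> SO; have [Q [oQ mQ bQ]] := prod_base.
pose N := \bigcup_(k in [set k | m (Q k) = 0%E]) Q k.
apply: (@negligibleS _ _ _ m N) => [z Sz|].
  have [G [oG Gz mG]] := SO z Sz.
  have [k [Qz QO]] := bQ G z oG Gz; exists k => //=.
  by apply: subset_measure0 mG => //; exact: open_measurable_prod.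
rewrite /N bigcup_mkcond; apply: negligible_bigcup => k.
case: ifPn => [/[!inE] mQ0|_]; last exact: negligible_set0.
by exists (Q k); split.
Qed.

End product_borel.

(** * Limit measure of samples along an ultrafilter *)

Section limit_measure.
Context {R : realType} {W X : pseudoPMetricType R}.
Hypothesis W2 : @second_countable W.
Hypothesis X_compact : compact [set: X].
Context {I : Type} (U : set_system I) (UU : UltraFilter U)
  (n : I -> nat) (w : forall i, 'I_(n i) -> W) (x : forall i, 'I_(n i) -> X).
Hypothesis n_gt0 : forall i, (0 < n i)%N.
Variable lam : probability (borel W) R.
Hypothesis w_lam : forall E : set (borel W), measurable E ->
  (n i)%:R^-1 * \sum_(k < n i) \1_E (w k) @[i --> U] --> fine (lam E).

Let PU : ProperFilter U := ultra_proper.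

Let X2 : @second_countable X := compact_second_countable X_compact.

Definition avg (i : I) (f : W * X -> R) : R := (n i)%:R^-1 * \sum_(k < n i) f (w k, x k).

Lemma avgD i f g : avg i (fun z => f z + g z) = avg i f + avg i g.
Proof. by rewrite /avg big_split mulrDr. Qed.

Lemma avgZ i c f : avg i (fun z => c * f z) = c * avg i f.
Proof. by rewrite /avg -mulr_sumr mulrCA. Qed.

Lemma avg1 i : avg i (fun=> 1) = 1.
Proof. by rewrite /avg sumr_const card_ord mulVf// pnatr_eq0 gtn_eqF. Qed.

Lemma le_avg i f g : (forall z, f z <= g z) -> avg i f <= avg i g.
Proof. by move=> fg; rewrite ler_wpM2l ?invr_ge0// ler_sum. Qed.

Lemma avg_cst i c : avg i (fun=> c) = c.
Proof.
rewrite -[RHS]mulr1 -(avg1 i) -avgZ; by congr avg; apply/funext => z; rewrite mulr1.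
Qed.

Lemma avg_ge0 i f : (forall z, 0 <= f z) -> 0 <= avg i f.
Proof. by move=> f0; rewrite -(avg_cst i 0) le_avg. Qed.

Lemma norm_avg i f M : (forall z, `|f z| <= M) -> `|avg i f| <= M.
Proof.
move=> fM; rewrite ler_norml; apply/andP; split.
  rewrite -[leLHS](avg_cst i); apply: le_avg => z.
  by have := fM z; rewrite ler_norml => /andP[].
rewrite -[leRHS](avg_cst i); apply: le_avg => z.
by have := fM z; rewrite ler_norml => /andP[].
Qed.

Definition ulim (f : W * X -> R) : R := lim (avg i f @[i --> U]).

Lemma ulim_cvg f M : (forall z, `|f z| <= M) -> avg i f @[i --> U] --> ulim f.
Proof.
by move=> fM; apply: (ultra_bounded_cvg (M := M)) => i; exact: norm_avg.
Qed.

Lemma ulim_bcont f : bcont f -> avg i f @[i --> U] --> ulim f.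
Proof. by move=> [_ [M fM]]; exact: ulim_cvg fM. Qed.

Lemma ulim_eq f l : avg i f @[i --> U] --> l -> ulim f = l.
Proof. by move=> fl; apply: cvg_lim. Qed.

(** For monotone continuity, let [E k] be the set of types over which [f k] reaches [D]. Then [f k]
    is at most [D] plus [M] times the indicator of [E k], which depends on the type alone, so
    setwise convergence of the types gives the bound [D + M * lam (E k)], and [lam (E k)] tends to
    0. *)
Lemma daniell_ulim : daniell ulim.
Proof.
split.
- move=> f g bf bg; apply: ulim_eq; under eq_fun do rewrite avgD.
  by apply: cvgD; exact: ulim_bcont.
- move=> c f bf; apply: ulim_eq; under eq_fun do rewrite avgZ.
  by apply: cvgMr; exact: ulim_bcont.
- move=> f bf f0; rewrite /ulim; apply: limr_ge.
    exact: cvgP (ulim_bcont bf).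
  by apply: nearW => i; exact: avg_ge0.
- by apply: ulim_eq; under eq_fun do rewrite avg1; exact: cvg_cst.
move=> f bf f0 fS fz e e0.
have fle a b z : (a <= b)%N -> f b z <= f a z.
  elim: b => [|b IH]; first by rewrite leqn0 => /eqP ->.
  by rewrite leq_eqVlt => /predU1P[->//|/IH]; exact: le_trans.
have [_ [M0 fM0]] := bf 0%N; pose M := `|M0| + 1.
have M_gt0 : 0 < M by rewrite ltr_wpDl.
have fM k z : f k z <= M.
  rewrite (le_trans (fle 0%N k z _))// (le_trans (ler_norm _))// (le_trans (fM0 z))//.
  by rewrite (le_trans (ler_norm _))// lerDl.
pose D := e / 2; have D0 : 0 < D by rewrite divr_gt0.
pose E k : set W := [set u | exists y, D <= f k (u, y)].
have cE k : closed (E k).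
  apply: (@closed_fst R W X [set z | D <= f k z] X_compact).
  apply: (@closed_comp _ _ (f k) [set r | D <= r]); last exact: closed_ge.
  by move=> z _; exact: (bf k).1.
have mE k : measurable (E k : set (borel W)).
  rewrite -[X in measurable X]setCK; apply: measurableC; apply: sub_sigma_algebra.
  exact: closed_openC.
(* Dini's argument on the compact fibre over [u]: one [k] brings [f k] below [D] on the whole
   fibre. *)
have E0 : \bigcap_k E k = set0.
  apply/seteqP; split => // u Eu.
  have := (compact_near_coveringP [set: X]).1 X_compact nat \oo (fun k y => f k (u, y) < D) _.
  move=> H; have : \forall k \near \oo, [set: X] `<=` (fun y => f k (u, y) < D).
    apply: H => y _; have [k0 hk0] := fz (u, y) D D0.
    have : nbhs (u, y) [set z | f k0 z < D].
      have := (bf k0).1 (u, y) [set r | r < D]; apply.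
      by apply: open_nbhs_nbhs; split => //; exact: open_lt.
    move=> [[A B] /= [Au By] AB]; exists (B, [set k | (k0 <= k)%N]) => /=.
      by split => //; exists k0.
    move=> [y' k] [/= By' k0k]; apply: (le_lt_trans (fle _ _ _ k0k)).
    by apply: (AB (u, y')); split => //=; exact: nbhs_singleton.
  move=> [k _ /(_ k (leqnn k)) hk]; have [y] := Eu k Logic.I.
  by rewrite leNgt hk.
have lE : fine (lam (E k)) @[k --> \oo] --> (0 : R).
  rewrite -[X in _ --> X]/(fine (0 : \bar R)) -(measure0 lam) -E0.
  apply: fine_cvg; rewrite fineK ?fin_num_measure//; last exact: bigcap_measurable.
  apply: nonincreasing_cvg_mu => //.
  - by rewrite -ge0_fin_numE// fin_num_measure.
  - exact: bigcap_measurable.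
  - move=> a b ab; apply/subsetPset => u [y hy]; exists y.
    exact: le_trans hy (fle _ _ _ ab).
have D2 : 0 < D / M by rewrite divr_gt0.
have [k hk] : exists k, fine (lam (E k)) < D / M.
  have nD : \forall k \near \oo, fine (lam (E k)) < D / M by exact: cvgr_lt lE _ D2.
  by have [k hk] := filter_ex nD; exists k.
exists k; apply: (@le_trans _ _ (D + M * fine (lam (E k)))).
  have c1 : D + M * ((n i)%:R^-1 * \sum_(j < n i) \1_(E k) (w j)) @[i --> U] -->
      D + M * fine (lam (E k)).
    by apply: cvgD; [exact: cvg_cst|apply: cvgMr; exact: w_lam].
  apply: (le_cvg_to PU (ulim_bcont (bf k)) c1) => i.
  have -> : D + M * ((n i)%:R^-1 * \sum_(j < n i) \1_(E k) (w j)) =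
      avg i (fun z => D + M * \1_(E k) z.1).
    by rewrite avgD avg_cst avgZ.
  apply: le_avg => -[u y]; rewrite indicE.
  have [_|] := boolP (u \in _); first by rewrite mulr1 (le_trans (fM _ _))// lerDr ltW.
  rewrite notin_setE mulr0 addr0 => nE; rewrite leNgt; apply/negP => /ltW h.
  by apply: nE; exists y.
rewrite [e]splitr lerD2l mulrC -ler_pdivlMr// ltW//.
Qed.

Lemma limit_exists : exists m : probability (borel W * borel X)%type R,
  forall f, bcont f -> avg i f @[i --> U] --> \int[m]_z f z.
Proof.
have [m hm] := riesz_prod W2 X2 daniell_ulim.
by exists m => f bf; rewrite hm//; exact: ulim_bcont.
Qed.

Variable m : probability (borel W * borel X)%type R.
Hypothesis m_lim : forall f, bcont f -> avg i f @[i --> U] --> \int[m]_z f z.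

(** The map [h] lets one statement serve open sets of [W], through the first projection, and open
    sets of the product. *)
Lemma Rint_bump_cvg (T : pseudoPMetricType R) d (S : measurableType d)
    (nu : probability S R) (h : S -> T) (O : set T) : open O ->
  (forall g : T -> R, bcont g -> bmeas (fun s => g (h s))) ->
  measurable (h @^-1` O) ->
  \int[nu]_s bump O j (h s) @[j --> \oo] --> fine (nu (h @^-1` O)).
Proof.
move=> oO mh mO; rewrite -Rint_indic//.
apply: (Rint_dominated (g := fun=> 1)).
- by move=> j; have [] := mh _ (bcont_bump O j).
- move=> s; apply: cvg_near_cst; have [Os|nO] := pselect (O (h s)).
    have [j0 hj] := bump1 oO Os; exists j0 => // j /= j0j.
    by rewrite hj// indicE mem_set.
  by apply: nearW => j; rewrite bump0// indicE memNset.
- exact/bmeas_integrable/bmeas_cst.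
- by move=> j s; rewrite ger0_norm ?bump_ge0 ?bump_le1.
Qed.

(** For a bump in the type variable, both integrals are limits of the same averages. Hence the two
    measures agree on open sets, a generating family closed under intersection. *)
Lemma limit_marg : marg_w m lam.
Proof.
have key O : open O -> fine (m (O `*` setT)) = fine (lam O).
  move=> oO.
  have mO : measurable (O : set (borel W)) by exact: sub_sigma_algebra.
  have -> : O `*` setT = (fst : borel W * borel X -> borel W) @^-1` O.
    by apply/seteqP; split => z /=; [case|].
  have c1 := @Rint_bump_cvg W _ _ m fst O oO.
  have c2 := @Rint_bump_cvg W _ _ lam id O oO.
  have bc (g : W -> R) : bcont g -> bcont (fun z : W * X => g z.1).
    move=> [cg [M gM]]; split; last by exists M.
    by move=> z; apply: continuous_comp; [exact: cvg_fst|exact: cg].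
  apply: (cvg_unique _ (c1 _ _) _) => //.
  - by move=> g bg; exact/(bcont_bmeas_prod W2 X2)/bc.
  - by rewrite -[X in measurable X]setTI; exact: measurable_fst.
  apply: cvg_trans (c2 _ _) => //; last by move=> g bg; exact: bcont_bmeas.
  suff -> : (fun j => \int[m]_s bump O j s.1) = (fun j => \int[lam]_s bump O j s) by [].
  apply/funext => j; have bb := bcont_bump O j.
  have h1 := m_lim (bc _ bb).
  have h2 : avg i (fun z => bump O j z.1) @[i --> U] --> \int[lam]_s bump O j s.
    apply: (posfun_cvg (L := fun i (g : borel W -> R) => (n i)%:R^-1 * \sum_(k < n i) g (w k))
      (L' := fun g => \int[lam]_s g s)).
    - move=> i; split.
      + by move=> f g _ _; rewrite big_split mulrDr.
      + by move=> c g _; rewrite -mulr_sumr mulrCA.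
      + by move=> g _ g0; rewrite mulr_ge0// sumr_ge0.
    - by move=> i; rewrite sumr_const card_ord mulVf// pnatr_eq0 gtn_eqF.
    - exact: posfun_Rint.
    - by move=> E mE; rewrite Rint_indic//; exact: w_lam.
    - exact: Rint_cst.
    - exact: bcont_bmeas.
  by rewrite -(cvg_lim _ h1)// -(cvg_lim _ h2).
move=> E mE.
have mfst : measurable_fun setT (fst : borel W * borel X -> borel W) by exact: measurable_fst.
have mfin (A : set (borel W)) : measurable A -> (pushforward m fst A = lam A)%E ->
  m (A `*` setT) = lam A.
  move=> mA <-; rewrite /pushforward; congr (m _).
  by apply/seteqP; split => z /=; [case|].
apply: mfin => //.
pose fst' : {mfun (borel W * borel X)%type >-> borel W} :=
  HB.pack (fst : borel W * borel X -> borel W) (isMeasurableFun.Build _ _ _ _ _ mfst).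
rewrite -[LHS]/(distribution m fst' E).
apply: (@measure_unique _ R (borel W) (@open W) (fun=> setT) _ _ _ _
  (distribution m fst') lam) => //.
- by move=> A B; exact: openI.
- by move=> _; exact: openT.
- by rewrite bigcup_const.
- move=> A oA; have mA : measurable (A : set (borel W)) by exact: sub_sigma_algebra.
  have mA' : measurable (A `*` [set: borel X]) by exact: measurableX.
  rewrite -[LHS](fineK _) ?fin_num_measure// -[RHS]fineK ?fin_num_measure//.
  rewrite -key//; congr (fine _)%:E; rewrite /distribution/= /pushforward; congr (m _).
  by apply/seteqP; split => z /=; [|case].
- by move=> k; rewrite -[X in (X < _)%E]/(distribution m fst' setT) probability_setT ltry.
Qed.

(** The average of every bump of [O] is eventually 0 along [U], so its integral is 0; these
    integrals converge to [m O]. *)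
Lemma limit_null (O : set (W * X)) : open O ->
  (\forall i \near U, forall k : 'I_(n i), ~ O (w k, x k)) -> m O = 0%E.
Proof.
move=> oO nO; have mO := open_measurable_prod W2 X2 oO.
rewrite -[LHS]fineK ?fin_num_measure//; congr _%:E.
have c1 := @Rint_bump_cvg (W * X)%type _ _ m id O oO (bcont_bmeas_prod W2 X2) mO.
rewrite -(cvg_lim _ c1)//.
suff -> : (fun j => \int[m]_s bump O j s) = (fun=> 0) by rewrite lim_cst.
apply/funext => j; rewrite -(cvg_lim _ (m_lim (bcont_bump O j)))//.
apply: lim_near_cst => //; apply: filterS nO => i hi.
by rewrite /avg big1 ?mulr0// => k _; rewrite bump0.
Qed.

Lemma integE (m' : probability (borel W * borel X)%type R) f : bcont f ->
  integ m' f = (\int[m']_z f z)%:E.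
Proof. by move=> bf; rewrite /integ EFin_Rint//; exact: bcont_bmeas_prod. Qed.

Hypothesis n_oo : forall N, \forall i \near U, (N <= n i)%N.

(* The neighbourhood survives one deviation, which moves the empirical measure by O(1/n). *)
Lemma limit_weak_open V : weak_open V -> V m ->
  \forall i \near U, forall (p : 'I_(n i) -> W * X) j,
    (forall k, k != j -> p k = (w k, x k)) -> V (empirical (p : 'I_(n i) -> borel W * borel X)).
Proof.
move=> oV Vm; have [l [fs [e [e0 bfs sV]]]] := oV m Vm.
have e2 : 0 < e / 2 by rewrite divr_gt0.
have bf a : bcont (fs a) by exact: bfs.
have h1 : \forall i \near U, forall a, `|avg i (fs a) - \int[m]_z fs a z| < e / 2.
  apply: filter_forall => a; have /cvgrPdist_lt/(_ _ e2) := m_lim (bf a).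
  by apply: filterS => i; rewrite distrC.
have h2 : \forall i \near U, forall a z z', (n i)%:R^-1 * `|fs a z - fs a z'| < e / 2.
  apply: filter_forall => a; have [_ [M fM]] := bf a.
  apply: filterS (n_oo (Num.truncn (2 * M / (e / 2))).+1) => i hi z z'.
  have n0 : 0 < (n i)%:R :> R by rewrite ltr0n.
  rewrite mulrC ltr_pdivrMr// mulrC -ltr_pdivrMr//.
  apply: (@lt_le_trans _ _ (Num.truncn (2 * M / (e / 2))).+1%:R); last by rewrite ler_nat.
  apply: le_lt_trans (Num.Theory.truncnS_gt _); rewrite ler_pM2r ?invr_gt0//.
  by rewrite (le_trans (ler_normB _ _))// mulr2n mulrDl mul1r lerD.
apply: filterS (filterI h1 h2) => i [{}h1 {}h2] p j pj.
apply: sV => a; rewrite !integE// -EFinB abse_EFin lte_fin.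
rewrite Rint_empirical//; last exact: bcont_bmeas_prod.
have -> : (n i)%:R^-1 * \sum_(k < n i) fs a (p k) =
    avg i (fs a) + (n i)%:R^-1 * (fs a (p j) - fs a (w j, x j)).
  rewrite /avg -mulrDr (bigD1 j)//= [in RHS](bigD1 j)//=; congr (_ * _).
  rewrite (eq_bigr (fun k => fs a (w k, x k))); last by move=> k /pj ->.
  by ring.
rewrite addrAC [e]splitr (le_lt_trans (ler_normD _ _))// ltrD//.
by rewrite normrM ger0_norm ?invr_ge0//; exact: h2.
Qed.

End limit_measure.

(** * Feasibility and optimality of the limit *)

Section limit_equilibrium.
Context {R : realType} {W X : pseudoPMetricType R}.

(** Neighbourhood form of the sequential condition. If it failed, types [ws k] within [1 / (k + 1)]
    of [w0] would have no feasible action in [V], against the subsequence converging to [y]. *)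
Lemma constraint_lower_hemicontinuous (C : W -> set X) (w0 : W) (y : X) (V : set X) :
  constraint_ok C -> C w0 y -> nbhs y V ->
  \forall w' \near w0, exists y', V y' /\ C w' y'.
Proof.
move=> [_ _ _ lhc] Cy Vy; apply: contrapT => nV.
have /choice[ws hws] k : exists w', ball w0 k.+1%:R^-1 w' /\ forall y', V y' -> ~ C w' y'.
  apply: contrapT => /forallNP H; apply: nV; apply/nbhs_ballP.
  exists k.+1%:R^-1; first by rewrite /= invr_gt0.
  move=> w' bw'; apply: contrapT => /forallNP nw'; apply: (H w'); split => // y' Vy' Cy'.
  by apply: (nw' y').
have cws : ws @ \oo --> w0.
  apply/cvg_ballP => e e0; exists (Num.truncn e^-1) => // k /= ke.
  apply: le_ball (hws k).1; rewrite -[leRHS]invrK lef_pV2 ?posrE ?invr_gt0//.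
  by rewrite (le_trans (ltW (Num.Theory.truncnS_gt _)))// ler_nat.
have [phi [xs [_ Cxs cxs]]] := lhc ws w0 y cws Cy.
have [k _ /(_ k (leqnn k)) Vk] := cxs _ Vy.
by have [_ /(_ (xs k) Vk)] := hws (phi k); apply; exact: Cxs.
Qed.

Hypothesis W2 : @second_countable W.
Hypothesis X_compact : compact [set: X].
Context {I : Type} (U : set_system I) (UU : UltraFilter U)
  (n : I -> nat) (w : forall i, 'I_(n i) -> W) (x : forall i, 'I_(n i) -> X).
Let PU : ProperFilter U := ultra_proper.
Hypothesis n_gt0 : forall i, (0 < n i)%N.
Hypothesis n_oo : forall N, \forall i \near U, (N <= n i)%N.
Variable m : probability (borel W * borel X)%type R.
Hypothesis m_lim : forall f : W * X -> R, bcont f -> avg w x i f @[i --> U] --> \int[m]_z f z.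
Variables (C : W -> set X) (F : probability (borel W * borel X)%type R -> W -> X -> R)
  (eps : nat -> R).
Hypothesis hC : constraint_ok C.
Hypothesis hF : bdd_cont_F F.
Hypothesis eps_cvg : eps @ \oo --> 0.
Hypothesis nash : forall i, eps_nash C F (eps (n i)) (@w i) (@x i).

Lemma limit_equilibrium :
  {ae m, forall z : borel W * borel X,
    C z.1 z.2 /\ F m z.1 z.2 = inf [set F m z.1 y | y in C z.1]}.
Proof.
have X2 : @second_countable X := compact_second_countable X_compact.
have [[M FM] cF] := hF; have [_ _ gC _] := hC.
have lbF m' w' : has_lbound [set F m' w' y | y in C w'].
  by exists (- M) => _ [y _ <-]; have := FM m' w' y; rewrite ler_norml => /andP[].
apply: (null_cover W2 X2) => -[w0 x0] /= nopt.
(* An infeasible point lies in the open complement of the graph, where no sample point falls. *)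
have [Cx0|nC] := pselect (C w0 x0); last first.
  exists (~` [set p : W * X | C p.1 p.2]); split => //; first exact: closed_openC.
  apply: (limit_null W2 X_compact UU m_lim); first exact: closed_openC.
  by apply: nearW => i k; apply; exact: (nash k).1.
have [y [Cy Fy]] : exists y, C w0 y /\ F m w0 y < F m w0 x0.
  apply: contrapT => /forallNP H; apply: nopt; split => //.
  apply/le_anti/andP; split; last by apply: ge_inf => //; exists x0.
  apply: lb_le_inf; first by exists (F m w0 x0); exists x0.
  by move=> _ [y Cy <-]; rewrite leNgt; apply/negP => Fy; apply: (H y).
(* Continuity of [F] at the current action and at the deviation costs two quarters, and [eps] costs
   less than a third, so a sample point near [(w0, x0)] would contradict the Nash inequality. *)
pose D := (F m w0 x0 - F m w0 y) / 4.
have D0 : 0 < D by rewrite divr_gt0// subr_gt0.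
have [U1 [V1 [V1' [oU1 mU1 wV1 xV1 h1]]]] := cF m w0 x0 D D0.
have [U2 [V2 [V2' [oU2 mU2 wV2 xV2 h2]]]] := cF m w0 y D D0.
(* The action [y] may be infeasible for a type near [w0]; lower hemicontinuity provides a feasible
   deviation close to it. *)
have V3 := constraint_lower_hemicontinuous hC Cy xV2.
pose V := V1 `&` V2 `&` [set w' | exists y', V2' y' /\ C w' y'].
have nV : nbhs w0 V by apply: filterI => //; exact: filterI.
exists (V `*` V1')°; split; first exact: open_interior.
  by exists (V, V1').
apply: (limit_null W2 X_compact UU m_lim); first exact: open_interior.
have e1 := limit_weak_open W2 X_compact UU n_gt0 m_lim n_oo oU1 mU1.
have e2 := limit_weak_open W2 X_compact UU n_gt0 m_lim n_oo oU2 mU2.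
have e3 : \forall i \near U, eps (n i) < D.
  have [N _ hN] : \forall k \near \oo, eps k < D by exact: cvgr_lt eps_cvg _ D0.
  by apply: filterS (n_oo N) => i; exact: hN.
apply: filterS (filterI (filterI e1 e2) e3) => i [[{}e1 {}e2] {}e3] k /interior_subset.
move=> [/= [[V1k V2k] [y' [V2y' Cy']]] V1xk].
have [_ nk] := nash k.
have {}h1 := h1 _ _ _ (e1 (fun k => (w k, x k)) k (fun _ _ => erefl)) V1k V1xk.
have {}e2 : U2 (empirical (fun l => (w l, if l == k then y' else x l) : borel W * borel X)).
  by apply: (e2 (fun l => (w l, if l == k then y' else x l)) k) => l /negbTE ->.
have {}h2 := h2 _ _ _ e2 V2k V2y'.
have h3 : inf [set F (empirical (fun l => (w l, if l == k then y else x l) : borel W * borel X))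
      (w k) y | y in C (w k)] <=
    F (empirical (fun l => (w l, if l == k then y' else x l) : borel W * borel X)) (w k) y'.
  apply: ge_inf; last by exists y'.
  exists (- M) => _ [y1 _ <-].
  have := FM (empirical (fun l => (w l, if l == k then y1 else x l) : borel W * borel X)) (w k) y1.
  by rewrite ler_norml => /andP[].
move: h1 h2 nk h3 e3; set a := F _ (w k) (x k); set b := F _ (w k) y'; set c := inf _.
move=> /ltr_distlCBl h1 /ltr_distlDr h2 nk h3 e3.
have D4 : 4 * D = F m w0 x0 - F m w0 y by rewrite mulrC divfK.
lra.
Qed.

End limit_equilibrium.

(** * Large deviations *)

Section absolutely_continuous_content.
Context {R : realType} d {T : measurableType d} (nu : probability T R) (L : set T -> R).
Hypothesis L_ge0 : forall A, 0 <= L A.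
Hypothesis L_setT : L setT = 1.
Hypothesis L_add : forall A B, A `&` B = set0 -> L (A `|` B) = L A + L B.
Hypothesis L_cont : forall e, 0 < e -> exists2 h, 0 < h &
  forall A, measurable A -> (nu A <= h%:E)%E -> L A <= e.

(** [L] is finitely additive on all subsets, as an ultrafilter limit of averages is; continuity with
    respect to [nu] concerns measurable sets only. *)
Definition content_measure (A : set T) : \bar R := (L A)%:E.

Let content_measure0 : content_measure set0 = 0%E.
Proof.
have := L_add (setI0 set0); rewrite setU0 => /eqP.
by rewrite -subr_eq0 opprD addNKr oppr_eq0 /content_measure => /eqP ->.
Qed.

Let content_measure_ge0 A : (0 <= content_measure A)%E.
Proof. by rewrite lee_fin. Qed.

(** The tails [V n] of the disjoint union decrease to the empty set, so [nu (V n)] tends to 0 and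
    [L_cont] carries this over to [L (V n)], the remainder of the partial sums. *)
Let content_measure_sigma_additive : semi_sigma_additive content_measure.
Proof.
move=> G mG tG mUG.
pose V n := \bigcup_i G (n + i)%N.
have mV n : measurable (V n) by exact: bigcup_measurable.
have disj n j : (n < j)%N -> G n `&` G j = set0.
  by move=> nj; move/trivIsetP : tG; apply => //; rewrite neq_ltn nj.
have VS n : V n = G n `|` V n.+1.
  apply/seteqP; split => [t [[|i] _ Gt]|t [Gt|[i _ Gt]]].
  - by left; rewrite addn0 in Gt.
  - by right; exists i => //; rewrite addSnnS.
  - by exists 0%N => //; rewrite addn0.
  - by exists i.+1 => //; rewrite -addSnnS.
have LV n : L (V n) = L (G n) + L (V n.+1).
  rewrite VS L_add//; apply/seteqP; split => // t [Gt [i _ Gt']].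
  have : (G n `&` G (n.+1 + i)%N) t by [].
  by rewrite disj// addSn ltnS leq_addr.
have LU n : L (\bigcup_k G k) = \sum_(0 <= k < n) L (G k) + L (V n).
  elim: n => [|n ->]; last by rewrite big_nat_recr//= LV addrA.
  by rewrite big_nil add0r; congr L; apply: eq_bigcup => // k _; rewrite add0n.
have V0 : \bigcap_n V n = set0.
  apply/seteqP; split => // t Vt.
  have [i _ Gt] := Vt 0%N Logic.I; have [j _ Gt'] := Vt i.+1 Logic.I.
  have : (G (0 + i)%N `&` G (i.+1 + j)%N) t by [].
  by rewrite disj// add0n addSn ltnS leq_addr.
have nuV : nu (V n) @[n --> \oo] --> 0%E.
  rewrite -(measure0 nu) -V0; apply: nonincreasing_cvg_mu => //.
  - by rewrite -ge0_fin_numE// fin_num_measure.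
  - exact: bigcap_measurable.
  - move=> a b ab; apply/subsetPset => t [i _ Gt]; exists (b - a + i)%N => //.
    by rewrite addnA subnKC.
have LV0 : L (V n) @[n --> \oo] --> (0 : R).
  apply/cvgrPdist_le => e e0; have [h h0 hL] := L_cont e0.
  have /fine_cvgP[_ /cvgrPdist_le/(_ _ h0)] := nuV.
  apply: filterS => n; rewrite !sub0r !normrN (ger0_norm (L_ge0 _)) => hn; apply: hL => //.
  by rewrite -[X in (X <= _)%E]fineK ?fin_num_measure// lee_fin (le_trans (ler_norm _)).
rewrite /content_measure.
have -> : (fun n => \sum_(0 <= k < n) (L (G k))%:E)%E =
    EFin \o (fun n => L (\bigcup_k G k) - L (V n)).
  by apply/funext => n; rewrite sumEFin/= (LU n) addrK.
apply: cvg_EFin; first exact: nearW.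
rewrite -[X in _ --> X]subr0; apply: cvgB => //; exact: cvg_cst.
Qed.

HB.instance Definition _ := isMeasure.Build _ _ _ content_measure
  content_measure0 content_measure_ge0 content_measure_sigma_additive.

Let content_measureT : content_measure setT = 1%E.
Proof. by rewrite /content_measure L_setT. Qed.

HB.instance Definition _ :=
  Measure_isProbability.Build _ _ _ content_measure content_measureT.

Lemma content_probability : exists m : probability T R, forall A, fine (m A) = L A.
Proof. by exists content_measure. Qed.

End absolutely_continuous_content.

(** * Finite criteria on type vectors for the equilibrium measure to lie in the target set *)

Section deterministic.
Context {R : realType} {W X : pseudoPMetricType R}.
Hypothesis W2 : @second_countable W.
Hypothesis X_compact : compact [set: X].
Variables (C : W -> set X) (F : probability (borel W * borel X)%type R -> W -> X -> R)
  (eps : nat -> R).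
Hypothesis hC : constraint_ok C.
Hypothesis hF : bdd_cont_F F.
Hypothesis eps_cvg : eps @ \oo --> 0.
Variable xh : forall n : nat, 'I_n -> ('I_n -> W) -> X.
Hypothesis xh_nash : forall n (w : 'I_n -> W), eps_nash C F (eps n) w (fun i => xh i w).
Variable A : set (probability (borel W * borel X)%type R).

(* Nonempty type vectors: the tag k stands for size k.+1, so that averages are normalized. *)
Definition profile := {k : nat & 'I_k.+1 -> W}.
Definition psize (i : profile) := (tag i).+1.
Definition ptype (i : profile) : 'I_(psize i) -> W := tagged i.
Arguments ptype : clear implicits.
Definition pact (i : profile) (k : 'I_(psize i)) : X := xh k (ptype i).
Arguments pact : clear implicits.
Definition pemp (i : profile) : probability (borel W * borel X)%type R :=
  empirical (fun k => (ptype i k, pact i k) : borel W * borel X).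
Definition pavg (g : W -> R) (i : profile) : R :=
  (psize i)%:R^-1 * \sum_(k < psize i) g (ptype i k).

Let posfun_pavg i : posfun (fun g : borel W -> R => pavg g i).
Proof.
split.
- by move=> f g _ _; rewrite /pavg big_split mulrDr.
- by move=> c g _; rewrite /pavg -mulr_sumr mulrCA.
- by move=> g _ g0; rewrite /pavg mulr_ge0// sumr_ge0.
Qed.

Let pavg1 i : pavg (fun=> 1) i = 1.
Proof. by rewrite /pavg sumr_const card_ord mulVf// pnatr_eq0. Qed.

Let norm_pavg g i M : (forall z, `|g z| <= M) -> `|pavg g i| <= M.
Proof.
move=> gM; rewrite /pavg normrM ger0_norm ?invr_ge0// mulrC ler_pdivrMr ?ltr0n//.
rewrite (le_trans (ler_norm_sum _ _ _))// (le_trans (ler_sum _ (fun k _ => gM _)))//.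
by rewrite sumr_const card_ord mulr_natr.
Qed.

Section along_ultrafilter.
Context (U : set_system profile) (UU : UltraFilter U).
Hypothesis U_oo : forall N, \forall i \near U, (N <= psize i)%N.
Variable lam : probability (borel W) R.
Hypothesis U_lam : forall E : set (borel W), measurable E ->
  pavg \1_E i @[i --> U] --> fine (lam E).

Lemma limit_point : exists m, Mset C F lam m /\
  forall V, weak_open V -> V m -> \forall i \near U, V (pemp i).
Proof.
have psize_gt0 i : (0 < psize i)%N by [].
have [m m_lim] := limit_exists W2 X_compact UU pact psize_gt0 U_lam.
exists m; split.
  split; first exact: (limit_marg W2 X_compact UU psize_gt0 U_lam m_lim).
  apply: (limit_equilibrium W2 X_compact UU psize_gt0 U_oo m_lim hC hF eps_cvg).
  by move=> i; exact: xh_nash.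
move=> V oV Vm.
apply: filterS (limit_weak_open W2 X_compact UU psize_gt0 m_lim U_oo oV Vm) => i.
by move/(_ (fun k => (ptype i k, pact i k)) (ord0 : 'I_(psize i))); apply.
Qed.

End along_ultrafilter.

(** If no finite family of sets sufficed, the failing profiles would generate a proper filter. Along
    an ultrafilter refining it the types converge setwise to [lam], so the limit point lies in the
    interior of [A] although [pemp] avoids [A]. *)
Lemma pemp_lower (lam : probability (borel W) R) :
  Mset C F lam `<=` weak_interior A ->
  exists (s : seq (set (borel W))) (e : R) (N : nat),
  [/\ forall E, List.In E s -> measurable E, 0 < e &
    forall i, (N <= psize i)%N ->
      (forall E, List.In E s -> `|pavg \1_E i - fine (lam E)| < e) -> A (pemp i)].
Proof.
move=> MA; apply: contrapT => nH.
pose D := [set p : seq (set (borel W)) * nat | forall E, List.In E p.1 -> measurable E].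
(* One natural number governs both the size and the tolerance, so that refining a pair tightens
   both. *)
pose B (p : seq (set (borel W)) * nat) := [set i : profile |
  [/\ (p.2 <= psize i)%N, forall E, List.In E p.1 ->
    `|pavg \1_E i - fine (lam E)| < p.2.+1%:R^-1 & ~ A (pemp i)]].
have PF : ProperFilter (filter_from D B).
  apply: filter_from_proper; last first.
    move=> [s N] /= Ds; apply: contrapT => nB; apply: nH.
    exists s, N.+1%:R^-1, N; split => // i Ni hi.
    by apply: contrapT => nA; apply: nB; exists i; split.
  apply: filter_from_filter; first by exists ([::], 0%N).
  move=> [s N] [s' N'] /= Ds Ds'; exists (s ++ s', maxn N N').
    by move=> E /= /List.in_app_iff[/Ds|/Ds'].
  move=> i [/= Ni hi nA]; split; split => //=.
  - by rewrite (leq_trans _ Ni)// leq_maxl.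
  - move=> E Es; apply: lt_le_trans (hi E _) _; first by apply/List.in_app_iff; left.
    by rewrite lef_pV2 ?posrE// ler_nat ltnS leq_maxl.
  - by rewrite (leq_trans _ Ni)// leq_maxr.
  - move=> E Es; apply: lt_le_trans (hi E _) _; first by apply/List.in_app_iff; right.
    by rewrite lef_pV2 ?posrE// ler_nat ltnS leq_maxr.
have [U [UU FU]] := ultraFilterLemma PF.
have Uoo N : \forall i \near U, (N <= psize i)%N.
  by apply: FU; exists ([::], N) => // i [].
have UA : \forall i \near U, ~ A (pemp i).
  by apply: FU; exists ([::], 0%N) => // i [].
have Ulam (E : set (borel W)) : measurable E -> pavg \1_E i @[i --> U] --> fine (lam E).
  move=> mE; apply/cvgrPdist_lt => e e0; apply: FU.
  exists ([:: E], Num.truncn e^-1); first by move=> E' [<-|[]].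
  move=> i [_ /(_ E (or_introl erefl)) h _] /=; rewrite distrC (lt_le_trans h)//=.
  rewrite -[leRHS]invrK lef_pV2 ?posrE ?invr_gt0//.
  exact/ltW/Num.Theory.truncnS_gt.
have PU : ProperFilter U by exact: ultra_proper.
have [m [mM mV]] := limit_point UU Uoo Ulam.
have [V [oV Vm VA]] := MA m mM.
by have [i [/VA]] := filter_ex (filterI (mV V oV Vm) UA).
Qed.

(** Otherwise an ultrafilter of profiles keeps [pemp] in [A] and every average of a bounded
    measurable [g] below its threshold. The limit law of the types then has entropy at most [r],
    while the limit point lies in the closure of [A] and in [Mall C F]. *)
Lemma pemp_upper (lam0 : probability (borel W) R) r :
  (forall m, weak_closure A m -> Mall C F m -> (r%:E < relent_w lam0 m)%E) ->
  exists (s : seq (borel W -> R)) (N : nat), (forall g, List.In g s -> bmeas g) /\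
    forall i, (N <= psize i)%N -> A (pemp i) ->
      exists g, List.In g s /\ r + ln (\int[lam0]_x expR (g x)) <= pavg g i.
Proof.
move=> rA; apply: contrapT => nH.
pose Z (g : borel W -> R) := r + ln (\int[lam0]_x expR (g x)).
pose D := [set p : seq (borel W -> R) * nat | forall g, List.In g p.1 -> bmeas g].
pose B (p : seq (borel W -> R) * nat) := [set i : profile |
  [/\ (p.2 <= psize i)%N, forall g, List.In g p.1 -> pavg g i < Z g & A (pemp i)]].
have PF : ProperFilter (filter_from D B).
  apply: filter_from_proper; last first.
    move=> [s N] /= Ds; apply: contrapT => nB; apply: nH.
    exists s, N; split => // i Ni Ai; apply: contrapT => /forallNP ng.
    apply: nB; exists i; split => // g gs /=.
    by rewrite ltNge; apply/negP => h; apply: (ng g).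
  apply: filter_from_filter; first by exists ([::], 0%N).
  move=> [s N] [s' N'] /= Ds Ds'; exists (s ++ s', maxn N N').
    by move=> E /= /List.in_app_iff[/Ds|/Ds'].
  move=> i [/= Ni hi nA]; split; split => //=.
  - by rewrite (leq_trans _ Ni)// leq_maxl.
  - by move=> g gs; apply: hi; apply/List.in_app_iff; left.
  - by rewrite (leq_trans _ Ni)// leq_maxr.
  - by move=> g gs; apply: hi; apply/List.in_app_iff; right.
have [U [UU FU]] := ultraFilterLemma PF.
have PU : ProperFilter U by exact: ultra_proper.
have Uoo N : \forall i \near U, (N <= psize i)%N.
  by apply: FU; exists ([::], N) => // i [].
have UA : \forall i \near U, A (pemp i).
  by apply: FU; exists ([::], 0%N) => // i [].
have UZ (g : borel W -> R) : bmeas g -> \forall i \near U, pavg g i < Z g.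
  move=> bg; apply: FU; exists ([:: g], 0%N); first by move=> g' [<-|[]].
  by move=> i [_ /(_ g (or_introl erefl))].
pose L (E : set W) : R := lim (pavg \1_E i @[i --> U]).
have cL (E : set W) : pavg \1_E i @[i --> U] --> L E.
  apply: (ultra_bounded_cvg (M := 1)) => i; apply: norm_pavg => z.
  by rewrite indicE; case: (_ \in _); rewrite ?normr1 ?normr0.
have [lam lamL] : exists lam : probability (borel W) R, forall E, fine (lam E) = L E.
  apply: (content_probability (nu := lam0)).
  - move=> E; rewrite /L; apply: limr_ge; first exact: cvgP (cL E).
    by apply: nearW => i; rewrite /pavg mulr_ge0// sumr_ge0// => k _; rewrite indicE.
  - by apply: cvg_lim => //; apply: cvg_near_cst; apply: nearW => i; rewrite indicT pavg1.
  - move=> E E' EE'; apply: cvg_lim => //.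
    have -> : (fun i => pavg \1_(E `|` E') i) = (fun i => pavg \1_E i + pavg \1_E' i).
      apply/funext => i; rewrite /pavg -mulrDr -big_split/=; congr (_ * _).
      apply: eq_bigr => k _; rewrite !indicE in_setU.
      have [/[!inE] kE|_] := boolP (_ \in E); last by rewrite mulr0n add0r.
      rewrite memNset ?mulr0n ?addr0// => kE'.
      by have : (E `&` E') (ptype i k) by []; rewrite EE'.
    by apply: cvgD; exact: cL.
  (* The threshold for [t * \1_E] gives [t * L E <= r + 1] as soon as [lam0 E <= 1 / (expR t - 1)],
     and this [t] turns the bound into [L E <= e]. *)
  - move=> e e0; pose t := (`|r| + 1) / e.
    have t0 : 0 < t by rewrite divr_gt0// ltr_wpDl.
    have et0 : 0 < expR t - 1 by rewrite subr_gt0 -expR0 ltr_expR.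
    exists (expR t - 1)^-1; first by rewrite invr_gt0.
    move=> E mE hE.
    have bE : bmeas (\1_E : borel W -> R) by exact: bmeas_indic.
    have := UZ _ (bmeasZ t bE).
    have -> : Z (fun x => t * \1_E x) = r + ln (1 + (expR t - 1) * fine (lam0 E)).
      rewrite /Z; congr (_ + ln _).
      have -> : (fun x => expR (t * \1_E x)) = fun x => 1 + (expR t - 1) * \1_E x.
        apply/funext => x; rewrite indicE; case: (x \in E); first by rewrite !mulr1 addrC subrK.
        by rewrite !mulr0 expR0 addr0.
      rewrite RintD; [|exact: bmeas_cst|exact: bmeasZ].
      by rewrite RintZ// Rint_indic// Rint_cst.
    have l0 : 0 <= fine (lam0 E) by exact: fine_ge0.
    have l1 : (expR t - 1) * fine (lam0 E) <= 1.
      by rewrite mulrC -ler_pdivlMr// div1r -lee_fin fineK ?fin_num_measure.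
    have hln : ln (1 + (expR t - 1) * fine (lam0 E)) <= 1.
      apply: le_trans l1; apply: le_ln1Dx.
      by rewrite (@lt_le_trans _ _ 0)// mulr_ge0// ltW.
    move=> hZ; rewrite /L; apply: limr_le; first exact: cvgP (cL E).
    apply: filterS hZ => i; rewrite (posfunZ (posfun_pavg i))// => hZ.
    rewrite -(ler_pM2l t0) (le_trans (ltW hZ))// /t divfK ?gt_eqF//.
    by rewrite lerD// ler_norm.
have Ulam (E : set (borel W)) : measurable E -> pavg \1_E i @[i --> U] --> fine (lam E).
  by move=> _; rewrite lamL; exact: cL.
have [m [mM mV]] := limit_point UU Uoo Ulam.
have mA : weak_closure A m.
  move=> V oV Vm; have [i [Vi Ai]] := filter_ex (filterI (mV V oV Vm) UA).
  by exists (pemp i).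
have := rA m mA; rewrite ltNge => /(_ (ex_intro _ lam mM)) /negP; apply.
apply: (@le_trans _ _ (relent lam lam0)).
  by apply: ereal_inf_lbound; exists lam => //; have [] := mM.
(* The strict inequalities along [U] pass to the limit as the variational inequality for [lam]. *)
apply: relent_le => g bg.
have cg : pavg g i @[i --> U] --> \int[lam]_x g x.
  apply: (posfun_cvg (L := fun i (g : borel W -> R) => pavg g i)
    (L' := fun g => \int[lam]_x g x)) => //.
  - exact: posfun_Rint.
  - by move=> E mE; rewrite Rint_indic//; exact: Ulam.
  - exact: Rint_cst.
rewrite -(cvg_lim _ cg)//; apply: limr_le; first exact: cvgP cg.
by apply: filterS (UZ g bg) => i /ltW.
Qed.

End deterministic.

(** * Outer probabilities and exponential rates *)

Section outer_probability.
Context {R : realType} d {T : measurableType d} (P : probability T R).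

Lemma pout_ge0 S : (0 <= pout P S)%E.
Proof. by apply: le_ereal_inf_tmp => _ [B _ <-]. Qed.

Lemma pout_le S B : measurable B -> S `<=` B -> (pout P S <= P B)%E.
Proof. by move=> mB SB; apply: ereal_inf_lbound; exists B. Qed.

Lemma pout_ge S B : measurable B -> B `<=` S -> (P B <= pout P S)%E.
Proof.
move=> mB BS; apply: le_ereal_inf_tmp => _ [G [mG SG] <-].
by apply: le_measure; rewrite ?inE//; exact: subset_trans SG.
Qed.

End outer_probability.

Section exponential_rates.
Context {R : realType}.
Implicit Types (x : (\bar R)^nat) (K r : R).

Lemma lne_expR_rate (n : nat) K r : 0 < K -> (0 < n)%N ->
  ((n%:R)^-1%:E * lne (K * expR (- (n%:R * r)))%:E)%E = (ln K / n%:R - r)%:E.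
Proof.
move=> K0 n0; rewrite lne_EFin ?mulr_gt0 ?expR_gt0// -EFinM; congr _%:E.
rewrite lnM ?posrE ?expR_gt0// expRK mulrDr mulrN mulKf ?pnatr_eq0 ?gtn_eqF//.
by rewrite mulrC.
Qed.

(** Constant prefactors disappear on the exponential scale. *)
Lemma cvg_rate K r : ln K / n%:R - r @[n --> \oo] --> - r.
Proof.
rewrite -[X in _ --> X]sub0r -[X in _ --> X - _](mulr0 (ln K)).
apply: cvgB; last exact: cvg_cst.
apply: cvgMr; rewrite -cvg_shiftS; exact: cvg_harmonic.
Qed.

Lemma rate_upper x K r : 0 < K -> (forall n, 0 <= x n)%E ->
  (\forall n \near \oo, x n <= (K * expR (- (n%:R * r)))%:E)%E ->
  (limn_esup (fun n => (n%:R)^-1%:E * lne (x n)) <= (- r)%:E)%E.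
Proof.
move=> K0 x0 xK; apply/lee_addgt0Pr => e e0; apply: limn_esup_le.
have /cvgrPdist_le/(_ _ e0) := @cvg_rate K r.
have n1 : \forall n \near \oo, (0 < n)%N by exists 1%N.
move=> c; apply: filterS (filterI (filterI xK n1) c) => n [[xn n0] cn].
apply: (@le_trans _ _ ((n%:R)^-1%:E * lne (K * expR (- (n%:R * r)))%:E)%E).
  apply: lee_wpmul2l; first by rewrite lee_fin invr_ge0.
  by rewrite lee_lne// in_itv/= ?x0 ?leey// lee_fin mulr_ge0 ?expR_ge0 ?(ltW K0).
rewrite lne_expR_rate// -EFinD lee_fin.
by move: cn; rewrite distrC => /ler_normlW; rewrite lerBlDl.
Qed.

Lemma rate_lower x K r : 0 < K ->
  (\forall n \near \oo, (K * expR (- (n%:R * r)))%:E <= x n)%E ->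
  ((- r)%:E <= limn_einf (fun n => (n%:R)^-1%:E * lne (x n)))%E.
Proof.
move=> K0 xK; apply/lee_subgt0Pr => e e0; apply: limn_einf_ge.
have /cvgrPdist_le/(_ _ e0) := @cvg_rate K r.
have n1 : \forall n \near \oo, (0 < n)%N by exists 1%N.
move=> c; apply: filterS (filterI (filterI xK n1) c) => n [[xn n0] cn].
apply: (@le_trans _ _ ((n%:R)^-1%:E * lne (K * expR (- (n%:R * r)))%:E)%E); last first.
  apply: lee_wpmul2l; first by rewrite lee_fin invr_ge0.
  have k0 : (0 <= (K * expR (- (n%:R * r)))%:E)%E.
    by rewrite lee_fin mulr_ge0 ?expR_ge0 ?(ltW K0).
  by rewrite lee_lne// in_itv/= ?k0 ?(le_trans k0) ?leey.
rewrite lne_expR_rate// -EFinB lee_fin.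
by move: cn => /ler_normlW; rewrite lerBlDl lerBlDr.
Qed.

Lemma ereal_lt_real (x y : \bar R) : (x < y)%E -> exists r : R, (x < r%:E < y)%E.
Proof.
case: x y => [x| |] [y| |] //=.
- rewrite lte_fin => xy; exists ((x + y) / 2); rewrite !lte_fin.
  by apply/andP; split; lra.
- by move=> _; exists (x + 1); rewrite lte_fin ltrDl ltr01 ltry.
- by move=> _; exists (y - 1); rewrite ltNyr lte_fin ltrBlDr ltrDl ltr01.
- by move=> _; exists 0; rewrite ltNyr ltry.
Qed.

End exponential_rates.

(** The union bound over the list comes with a measurable [B], as required to bound an outer
    probability from above. *)
Lemma chernoff_union {R : realType} dO (Om : measurableType dO) (P : probability Om R)
  (T : ptopologicalType) (Ws : nat -> Om -> borel T) (lam0 : probability (borel T) R)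
  (s : seq (borel T -> R)) (r : R) (n : nat) :
  iid_law P Ws lam0 -> (forall g, List.In g s -> bmeas g) ->
  exists B, [/\ measurable B,
    forall om g, List.In g s ->
      n%:R * (r + ln (\int[lam0]_x expR (g x))) <= wsum Ws g n om -> B om &
    (P B <= ((size s)%:R * expR (- (n%:R * r)))%:E)%E].
Proof.
move=> iid; elim: s => [_|g s IH bs].
  by exists set0; rewrite measure0 mul0r.
have [|B [mB sB PB]] := IH; first by move=> g' gs; apply: bs; right.
have bg : bmeas g by apply: bs; left.
pose S := [set om | n%:R * (r + ln (\int[lam0]_x expR (g x))) <= wsum Ws g n om].
have mS : measurable S.
  have -> : S = [set om | 0 <= wsum Ws g n om - n%:R * (r + ln (\int[lam0]_x expR (g x)))].
    by apply/seteqP; split => om; rewrite /S/= subr_ge0.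
  by apply: measurable_ge0; apply: bmeasB; [exact: (bmeas_wsum iid n bg)|exact: bmeas_cst].
exists (S `|` B); split; first exact: measurableU.
  by move=> om g' [<- h|g's h]; [left|right; exact: sB h].
apply: (le_trans (measureU2 _ mS mB)).
rewrite -[size _]/(size s).+1 -natr1 mulrDl mul1r addrC EFinD; apply: leeD => //.
exact: (iid_chernoff iid).
Qed.

(** * Deviation rates of the equilibrium measures *)

Section deviations.
Context {R : realType} {W X : pseudoPMetricType R}.
Hypothesis W2 : @second_countable W.
Hypothesis X_compact : compact [set: X].
Variables (C : W -> set X) (F : probability (borel W * borel X)%type R -> W -> X -> R)
  (eps : nat -> R).
Hypothesis hC : constraint_ok C.
Hypothesis hF : bdd_cont_F F.
Hypothesis eps_cvg : eps @ \oo --> 0.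
Variable xh : forall n : nat, 'I_n -> ('I_n -> W) -> X.
Hypothesis xh_nash : forall n (w : 'I_n -> W), eps_nash C F (eps n) w (fun i => xh i w).
Variable A : set (probability (borel W * borel X)%type R).
Context (lam0 : probability (borel W) R) dO (Om : measurableType dO) (P : probability Om R)
  (Ws : nat -> Om -> borel W).
Hypothesis Ws_iid : iid_law P Ws lam0.

Let mu n (om : Om) : probability (borel W * borel X)%type R :=
  empirical (fun i : 'I_n =>
    (Ws i om, xh i (fun j : 'I_n => Ws j om)) : borel W * borel X).
Let event n := pout P [set om | A (mu n om)].
Let rate n := ((n%:R)^-1%:E * lne (event n))%E.

Lemma rate_limsup_le r :
  (forall m, weak_closure A m -> Mall C F m -> (r%:E < relent_w lam0 m)%E) ->
  (limn_esup rate <= (- r)%:E)%E.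
Proof.
move=> hr; have [s [N [bs hs]]] := pemp_upper W2 X_compact hC hF eps_cvg xh_nash hr.
(* The successor keeps the prefactor positive when [s] is empty. *)
apply: (rate_upper (K := (size s).+1%:R)) => [//|n|]; first exact: pout_ge0.
(* Starting at [N.+1] excludes the empty sample; a profile with tag [n] has size [n.+1]. *)
exists N.+1 => // -[//|n] /= Nn.
have [B [mB sB PB]] := chernoff_union r n.+1 Ws_iid bs.
apply: (@le_trans _ _ (P B)).
  apply: pout_le => // om /= Aom.
  pose i : profile := existT _ n (fun j : 'I_n.+1 => Ws j om).
  have [g [gs hg]] := hs i (ltnW Nn) Aom.
  apply: (sB om g gs); move: hg; rewrite /pavg mulrC ler_pdivlMr// mulrC.
  exact.
by apply: (le_trans PB); rewrite lee_fin ler_wpM2r ?expR_ge0// ler_nat.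
Qed.

Lemma rate_liminf_ge (lam : probability (borel W) R) r :
  Mset C F lam `<=` weak_interior A -> (relent lam lam0 < r%:E)%E ->
  ((- r)%:E <= limn_einf rate)%E.
Proof.
move=> MA hr.
have [s [e [N [ms e0 hs]]]] := pemp_lower W2 X_compact hC hF eps_cvg xh_nash MA.
pose E (j : 'I_(size s)) := nth set0 s j.
have Es j : List.In (E j) s.
  rewrite /E; case: j => /= j; elim: s j {ms hs E} => // E s IH [|j] /= js; [by left|].
  by right; exact: IH.
have sE G : List.In G s -> exists j, G = E j.
  rewrite /E; elim: s {ms hs E Es} => // E s IH /= [<-|/IH[j ->]].
    by exists ord0.
  by exists (lift ord0 j).
have mE j : measurable (E j) by exact: ms.
have e2 : 0 < e / 2 by rewrite divr_gt0.
have [h [a [[bh a0 ah] [h1 hH hE]]]] := relent_approx hr mE e2.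
pose sg (b : bool) : R := (-1) ^+ b.
(* One function per set and sign, so that two one-sided bounds control the absolute deviation. Its
   mean under [h] is negative because [h] matches [lam] on each set within [e / 2]. *)
pose u (jb : 'I_(size s) * bool) (t : borel W) : R :=
  sg jb.2 * (\1_(E jb.1) t - fine (lam (E jb.1))) - e / 2.
have bE j : bmeas (fun t : borel W => \1_(E j) t - fine (lam (E j)) : R).
  by apply: bmeasB; [exact: bmeas_indic|exact: bmeas_cst].
have bu jb : bmeas (u jb).
  by apply: bmeasB; [exact: bmeasZ|exact: bmeas_cst].
have hu jb : \int[lam0]_x (h x * u jb x) < 0.
  case: jb => j b; rewrite /u /=.
  have -> : (fun t => h t * (sg b * (\1_(E j) t - fine (lam (E j))) - e / 2)) =
      (fun t => sg b * (h t * \1_(E j) t) - (sg b * fine (lam (E j)) + e / 2) * h t).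
    by apply/funext => t; ring.
  have b1 := bmeasM bh (bmeas_indic (R := R) (mE j)).
  rewrite RintB; [|exact: bmeasZ|exact: bmeasZ].
  rewrite !RintZ// h1 mulr1 opprD addrA -mulrBr subr_lt0.
  rewrite (le_lt_trans (ler_norm _))// normrM /sg normrX normrN1 expr1n mul1r.
  exact: hE.
have := iid_lower Ws_iid bu bh a0 ah h1 hu hH.
move=> hl; apply: (rate_lower (K := 2^-1)); first by rewrite invr_gt0.
have nN : \forall n \near \oo, (N.+1 <= n)%N by exists N.+1.
apply: filterS (filterI hl nN) => n [{}hl {}nN]; apply: (le_trans hl).
apply: pout_ge.
  apply: fin_bigcap_measurable => // jb _; apply: measurableC.
  exact: (measurable_wbad Ws_iid n (bu jb)).
case: n nN {hl} => // n nN om hom.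
pose i : profile := existT _ n (fun j : 'I_n.+1 => Ws j om).
apply: (hs i (ltnW nN)) => G /sE[j ->].
have n0 : 0 < n.+1%:R :> R by [].
have key b : sg b * (pavg \1_(E j) i - fine (lam (E j))) < e / 2.
  have := hom (j, b) Logic.I; rewrite /wbad/= => /negP; rewrite -ltNge /wsum.
  have -> : \sum_(k < n.+1) u (j, b) (Ws k om) =
      sg b * (\sum_(k < n.+1) \1_(E j) (Ws k om) - n.+1%:R * fine (lam (E j))) -
      n.+1%:R * (e / 2).
    by rewrite /u sumrB -mulr_sumr sumrB !sumr_const card_ord !mulr_natl.
  rewrite subr_lt0 => hlt.
  by rewrite -(ltr_pM2l n0) mulrCA mulrBr /pavg mulVKf ?gt_eqF.
have := key true; have := key false; rewrite /sg expr0 mul1r expr1 mulN1r => k1 k2.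
rewrite ltr_norml ltrNl; apply/andP; split.
  by apply: (lt_trans k2); rewrite ltr_pdivrMr// ltr_pMr// ltr1n.
by apply: (lt_trans k1); rewrite ltr_pdivrMr// ltr_pMr// ltr1n.
Qed.

Lemma relent_liminf_ge (lam : probability (borel W) R) :
  Mset C F lam `<=` weak_interior A -> (- limn_einf rate <= relent lam lam0)%E.
Proof.
move=> MA; rewrite leNgt; apply/negP => /ereal_lt_real[r /andP[hr]].
by rewrite lteNr -EFinN ltNge (rate_liminf_ge MA hr).
Qed.

End deviations.

Lemma relent_abs_cont {R : realType} d {T : measurableType d} (lam lam0 : probability T R) :
  (relent lam lam0 < +oo)%E -> abs_cont lam lam0.
Proof.
move=> /ereal_inf_lt[_ [f [mf f0 lamE] _] _] E mE E0.
rewrite lamE//; apply: null_set_integral => //.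
by apply: measurable_funTS; exact/measurable_EFinP.
Qed.

Lemma meq_integ {R : realType} {W X : ptopologicalType}
  (m m' : probability (borel W * borel X)%type R) f : meq m m' -> integ m f = integ m' f.
Proof. by move=> mm'; apply: eq_measure_integral => E mE _; exact: mm'. Qed.

(** * Assembly of the large deviation bounds *)

Unset Implicit Arguments.

Theorem theorem3p9 (R : realType)
  (W : completePseudoMetricType R) (X : pseudoPMetricType R)
  (W_hausdorff : hausdorff_space W)
  (W_separable : exists D : set W, countable D /\ dense D)
  (X_hausdorff : hausdorff_space X) (X_compact : compact [set: X])
  (C : W -> set X) (hC : constraint_ok C)
  (F : probability (borel W * borel X)%type R -> W -> X -> R)
  (hF : bdd_cont_F F)
  (eps : nat -> R) (eps_ge0 : forall n, 0 <= eps n)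
  (eps_cvg : eps @ \oo --> 0)
  (lam0 : probability (borel W) R)
  (dO : measure_display) (Om : measurableType dO) (P : probability Om R)
  (Ws : nat -> Om -> borel W) (Ws_iid : iid_law P Ws lam0)
  (xh : forall n : nat, 'I_n -> prodn W n -> X)
  (xh_meas : forall n (i : 'I_n),
     univ_meas (R:=R) (xh n i : prodn W n -> borel X))
  (xh_nash : forall n (w : 'I_n -> W),
     eps_nash C F (eps n) w (fun i => xh n i w)) :
  let mu n (om : Om) : probability (borel W * borel X)%type R :=
    empirical (fun i : 'I_n =>
      (Ws i om, xh n i (fun j : 'I_n => Ws j om)) : borel W * borel X) in
  let rate (A : set (probability (borel W * borel X)%type R)) (n : nat) :=
    ((n%:R)^-1%:E * lne (pout P [set om | A (mu n om)]))%E in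
  forall A : set (probability (borel W * borel X)%type R),
    weak_measurable A ->
    [/\ (limn_esup (rate A) <=
           - ereal_inf [set relent_w lam0 m | m in weak_closure A `&` Mall C F])%E,
        (- ereal_inf [set relent lam lam0 |
                       lam in [set lam | Mset C F lam `<=` weak_interior A]]
           <= limn_einf (rate A))%E &
        (forall lam : probability (borel W) R, abs_cont lam lam0 ->
           exists m, Mset C F lam m /\ forall m', Mset C F lam m' -> meq m' m) ->
        (- ereal_inf [set relent_w lam0 m | m in weak_interior A `&` Mall C F]
           <= limn_einf (rate A))%E].
Proof.
move=> mu rate A _.
have W2 : @second_countable W := separable_second_countable W_separable.
have bound (lam : probability (borel W) R) : Mset C F lam `<=` weak_interior A ->
    (- limn_einf (rate A) <= relent lam lam0)%E.
  exact: (relent_liminf_ge W2 X_compact hC hF eps_cvg xh_nash Ws_iid).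
split.
(* A failure of the bound leaves room for a real [r] strictly below the infimum, and
   [rate_limsup_le] at this [r] refutes it. *)
- rewrite leNgt; apply/negP; rewrite lteNl => /ereal_lt_real[r /andP[rL rI]].
  move: rL; rewrite lteNl ltNge -EFinN => /negP; apply.
  apply: (rate_limsup_le W2 X_compact hC hF eps_cvg xh_nash Ws_iid) => m mA mM.
  by apply: (lt_le_trans rI); apply: ereal_inf_lbound; exists m.
- by rewrite leeNl; apply: le_ereal_inf_tmp => _ [lam MA <-]; exact: bound.
move=> sing; rewrite leeNl; apply: le_ereal_inf_tmp => _ [m [[V [oV Vm VA]] [lam' [_ mC]]] <-].
apply: le_ereal_inf_tmp => _ [lam mlam <-].
(* Finite entropy yields absolute continuity, hence the singleton hypothesis for the marginal [lam]
   of [m]. *)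
have [->|fin] := eqVneq (relent lam lam0) +oo%E; first exact: leey.
have lam_fin : (relent lam lam0 < +oo)%E by rewrite ltey.
have [m0 [_ H]] := sing lam (relent_abs_cont lam_fin).
apply: bound => m' Mm'.
have mm' : meq m' m.
  by move=> E mE; rewrite (H m' Mm' E mE) -(H m _ E mE).
(* Uniqueness holds up to equality on measurable sets. Such measures have equal integrals, so a
   basic neighbourhood of [m] inside [V] contains [m'] as well. *)
have [k [fs [e [e0 bfs sV]]]] := oV m Vm.
exists V; split => //; apply: sV => i; rewrite (meq_integ _ mm').
rewrite (integE W2 X_compact m (bfs i)).
by rewrite -EFinB abse_EFin lte_fin subrr normr0.
Qed.
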